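(* Let $Y = Tf^\dagger + \sigma Z$ be the statistical linear inverse problem described in the context, and suppose that there are $0<c_{\min}\le c_{\max}$ and $a>1$ such that the eigenvalues of $T^*T$ satisfy $c_{\min}k^{-a}\le\lambda_k\le c_{\max}k^{-a}$ for all $k\in\mathbb N$. Let $\varphi=\varphi_{\nu,\tau}$, $\varphi_{\nu,\tau}(x)=x^\nu(-\log x)^{-\tau}$ (with $\varphi_{\nu,\tau}(0)=0$), where either $\nu>0$ and $\tau\in\mathbb R$, or $\nu=0$ and $\tau>0$, and let $\rho>0$. Let $(q_\alpha)_{\alpha\in\mathcal A}$ be an ordered filter such that $\varphi$ is a qualification of it, i.e. there is a constant $C_\varphi$ with $$\sup_{x\in[0,\|T^*T\|]}\varphi(x)\,(1-xq_\alpha(x))\le C_\varphi\,\varphi(\alpha)\quad\text{for all }\alpha\in\mathcal A\cap(0,\lambda_1].$$ Let $(\alpha_m)_{m\in\mathbb N_0}\subset\mathcal A\cap(0,\lambda_1]$ be a candidate sequence with constants $1<\theta_1\le\theta_2<\infty$, and assume that there is a constant $c_{\rm v}>0$ such that $$\mathrm v_m\ \ge\ c_{\rm v}\,\sigma^2\,\frac{S(\alpha_m)}{\alpha_m}\quad\text{for all } m\in\mathbb N_0,\qquad\text{where } S:(0,\lambda_1]\to[0,\infty)\text{ is continuous with } S(x)\asymp x^{-1/a}.$$ Let $\beta,\gamma>0$, let $\hat f_\alpha=q_\alpha(T^*T)T^*Y$, and let $\alpha_{\hat m}\in\{\alpha_0,\dots,\alpha_{m_{\max}}\}$ be chosen by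 the SOLIT rule with parameters $\beta,\gamma$. Then there is a constant $C>0$, independent of $\sigma$, such that for all sufficiently small $\sigma>0$ $$\sup_{f^\dagger\in\mathcal W_\varphi(\rho)}\mathbb E\big[\|\hat f_{\alpha_{\hat m}}-f^\dagger\|^2\big]\ \le\ C\,(\sigma^2)^{\frac{2\nu}{2\nu+1/a+1}}\,(-\log\sigma^2)^{-\frac{2\tau(1+1/a)}{2\nu+1+1/a}}.$$
   Context: **Model.** $\mathcal X,\mathcal Y$ are separable Hilbert spaces, $T:\mathcal X\to\mathcal Y$ is a linear, injective Hilbert–Schmidt operator, $f^\dagger\in\mathcal X$ is the unknown truth, $\sigma>0$ is the noise level, and $Z$ is the standard Gaussian Hilbert space process on $\mathcal Y$ (for each $y\in\mathcal Y$, $Z(y)$ is a centered real Gaussian variable, jointly Gaussian, with $\mathrm{Cov}(Z(y),Z(y'))=\langle y,y'\rangle$). The model $Y=Tf^\dagger+\sigma Z$ means that one observes $\langle Y,y\rangle=\langle Tf^\dagger,y\rangle+\sigma Z(y)$ for all $y\in\mathcal Y$. Since $T$ is Hilbert–Schmidt, $T^*Y$ and $T^*Z$ are (a.s.) $\mathcal X$-valued. $T^*T$ has an orthonormal eigenbasis $(e_k)_{k\in\mathbb N}$ with eigenvalues $\lambda_1\ge\lambda_2\ge\dots>0$, $\sum_k\lambda_k<\infty$, and it is assumed (without loss of generality) that $\lambda_1\le e^{-1}$. **Source set.** $\mathcal W_\varphi(\rho)=\{f\in\mathcal X: f=\varphi(T^*T)g\text{ for some }g\in\mathcal X,\ \|g\|\le\rho\}$.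 **Ordered filter.** Let $\mathcal A\subset(0,\infty)$ have $0$ as an accumulation point. A family of functions $q_\alpha:[0,\|T^*T\|]\to[0,\infty)$, $\alpha\in\mathcal A$, is an ordered filter if (i) there is a constant $C_q'$ with $\alpha q_\alpha(x)\le C_q'$ and $xq_\alpha(x)\le1$ for all $x\in[0,\|T^*T\|]$, $\alpha\in\mathcal A$; (ii) $\alpha\ge\tilde\alpha$ implies $q_\alpha(x)\le q_{\tilde\alpha}(x)$ for all $x$. **Candidates.** Put $V(\alpha)=\sum_{k\ge1}\lambda_kq_\alpha(\lambda_k)^2$ for $\alpha\in\mathcal A$. A candidate sequence with constants $1<\theta_1\le\theta_2<\infty$ is a strictly decreasing sequence $\alpha_0>\alpha_1>\cdots$ in $\mathcal A$, not depending on $\sigma$, with $\theta_1\le V(\alpha_m)/V(\alpha_{m-1})\le\theta_2$ for all $m\ge1$. Put $\mathrm v_m=\sigma^2V(\alpha_m)$ and $m_{\max}=\min\{m\in\mathbb N:\sigma^2V(\alpha_m)\ge1\}$. **SOLIT rule.** For $m_1,m_2\in\{0,\dots,m_{\max}\}$ let $\mathrm v_{m_1,m_2}=\sigma^2\sum_{k}\lambda_k(q_{\alpha_{m_1}}(\lambda_k)-q_{\alpha_{m_2}}(\lambda_k))^2$ and $\mathrm n_{m_1,m_2}=\|q_{\alpha_{m_1}}(T^*T)T^*Z-q_{\alpha_{m_2}}(T^*T)T^*Z\|$. For $m_1<m_2$ let $z_{m_1,m_2}(x)$ be such that $\mathbb P\{\mathrm n_{m_1,m_2}>z_{m_1,m_2}(x)\}=e^{-x}$,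 let $x_m=2(1+\gamma)\log(\mathrm v_{m+1}/\mathrm v_0)$, and let $\eta_{m_1,m_2}=\sigma z_{m_1,m_2}(x_{m_1})+\beta\sqrt{\mathrm v_{m_1,m_2}}$. Then $$\hat m=\min\Big\{0\le m_1\le m_{\max}:\ \|\hat f_{\alpha_{m_1}}-\hat f_{\alpha_{m_2}}\|\le\eta_{m_1,m_2}\ \text{ for all } m_1<m_2\le m_{\max}\Big\}$$ (the condition is vacuous for $m_1=m_{\max}$). **Notation.** $S(x)\asymp x^{-1/a}$ means that $S(x)$ is bounded above and below by positive constant multiples of $x^{-1/a}$ on $(0,\lambda_1]$. *)

(* Defs.v *)
From HB Require Import structures.
From mathcomp Require Import all_boot all_order all_algebra.
From mathcomp Require Import all_classical all_reals all_analysis.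

Set Implicit Arguments.
Unset Strict Implicit.
Unset Printing Implicit Defensive.

Import Order.TTheory GRing.Theory Num.Theory.
Import numFieldNormedType.Exports.

Local Open Scope classical_set_scope.
Local Open Scope ring_scope.

(* A real Hilbert space is a completeNormedModType over R together with an
   inner product [ip : {dot X for idfun}] inducing the norm. *)
Definition separable_hilbert (R : realType) (X : completeNormedModType R)
    (ip : {dot X for idfun}) : Prop :=
  (forall x : X, `|x| ^+ 2 = ip x x) /\
  exists D : set X, countable D /\ dense D.

Definition orthonormal_basis (R : realType) (X : completeNormedModType R)
    (ip : {dot X for idfun}) (I : set nat) (u : nat -> X) : Prop :=
  (forall j k, I j -> I k -> ip (u j) (u k) = (j == k)%:R) /\
  (forall x : X,
     (fun n => \sum_(0 <= k < n | k \in I) ip x (u k) *: u k) @ \oo --> x).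

(* The index set I of the basis is arbitrary, so that X may also have finite
   dimension; continuity does not follow from summability on one basis. *)
Definition hilbert_schmidt (R : realType) (X Y : completeNormedModType R)
    (ip : {dot X for idfun}) (T : X -> Y) : Prop :=
  continuous T /\
  exists (I : set nat) (u : nat -> X), orthonormal_basis ip I u /\
    (\esum_(k in I) (`|T (u k)| ^+ 2)%:E < +oo)%E.

Definition is_adjoint (R : realType) (X Y : completeNormedModType R)
    (ipX : {dot X for idfun}) (ipY : {dot Y for idfun})
    (T : X -> Y) (Ts : Y -> X) : Prop :=
  forall x y, ipY (T x) y = ipX x (Ts y).

Definition opnorm (R : realType) (X Y : completeNormedModType R)
    (A : X -> Y) : R :=
  sup [set `|A x| | x in [set x | `|x| <= 1]].

(* The eigenvalue usually written lambda_k, k >= 1, is [lam k.-1]. *)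
Definition eigenbasis (R : realType) (X : completeNormedModType R)
    (ip : {dot X for idfun}) (A : X -> X)
    (lam : nat -> R) (e : nat -> X) : Prop :=
  [/\ orthonormal_basis ip setT e,
      forall k, A (e k) = lam k *: e k,
      forall k, 0 < lam k,
      forall j k, (j <= k)%N -> lam k <= lam j
    & cvgn (series lam)].

(* g(A) x for the operator A diagonalized by (e k) with eigenvalues (lam k). *)
Definition funcalc (R : realType) (X : completeNormedModType R)
    (ip : {dot X for idfun}) (lam : nat -> R) (e : nat -> X)
    (g : R -> R) (x : X) : X :=
  limn (series (fun k => (g (lam k) * ip x (e k)) *: e k)).

Definition source_set (R : realType) (X : completeNormedModType R)
    (ip : {dot X for idfun}) (lam : nat -> R) (e : nat -> X)
    (phi : R -> R) (rho : R) : set X :=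
  [set f | exists2 g : X, f = funcalc ip lam e phi g & `|g| <= rho].

Definition is_gaussian (R : realType) (d : measure_display)
    (Omega : measurableType d) (P : probability Omega R)
    (X : Omega -> R) : Prop :=
  exists m s : R, forall B : set R, measurable B ->
    (* normal_prob m 0 is not the Dirac mass in the library *)
    P (X @^-1` B) = if s == 0 then \d_m B else normal_prob m s B.

Definition standard_gaussian_process (R : realType)
    (Y : completeNormedModType R) (ip : {dot Y for idfun})
    (d : measure_display) (Omega : measurableType d)
    (P : probability Omega R) (Z : Y -> {RV P >-> R}) : Prop :=
  [/\ forall (n : nat) (c : 'I_n -> R) (y : 'I_n -> Y),
        is_gaussian P (fun w => \sum_(i < n) c i * Z (y i) w),
      forall y, ('E_P[Z y] = 0)%E
    & forall y y', covariance P (Z y) (Z y') = (ip y y')%:E].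

(* The realization y |-> <Y, y> of the data Y = T f + s Z at w. *)
Definition observation (R : realType) (X Y : completeNormedModType R)
    (ip : {dot Y for idfun}) (T : X -> Y) (d : measure_display)
    (Omega : measurableType d) (P : probability Omega R)
    (Z : Y -> {RV P >-> R}) (f : X) (s : R) (w : Omega) : Y -> R :=
  fun y => ip (T f) y + s * Z y w.

(* T^* W for (a realization of) a process W indexed by Y: the element of X
   whose inner product with each (e k) is W (T (e k)).  For W = Y or W = Z the
   series converges almost surely; elsewhere limn takes a default value. *)
Definition adjoint_process (R : realType) (X Y : completeNormedModType R)
    (e : nat -> X) (T : X -> Y) (W : Y -> R) : X :=
  limn (series (fun k => W (T (e k)) *: e k)).

Definition estimator (R : realType) (X Y : completeNormedModType R)
    (ip : {dot X for idfun}) (lam : nat -> R) (e : nat -> X) (T : X -> Y)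
    (g : R -> R) (W : Y -> R) : X :=
  funcalc ip lam e g (adjoint_process e T W).

Definition phi_index (R : realType) (nu tau x : R) : R :=
  if x == 0 then 0 else x `^ nu * (- ln x) `^ (- tau).

(* M stands for the operator norm of T^* T. *)
Definition ordered_filter (R : realType) (A : set R) (M : R)
    (q : R -> R -> R) : Prop :=
  [/\ A `<=` `]0, +oo[,
      limit_point A 0,
      forall al x : R, A al -> x \in `[0, M] -> 0 <= q al x,
      exists C : R, forall al x : R, A al -> x \in `[0, M] ->
        al * q al x <= C /\ x * q al x <= 1
    & forall al al' x : R, A al -> A al' -> x \in `[0, M] ->
        al' <= al -> q al x <= q al' x].

Definition qualification (R : realType) (A : set R) (M lam1 : R)
    (q : R -> R -> R) (phi : R -> R) : Prop :=
  exists C : R, forall al, A al -> al \in `]0, lam1] ->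
    (ereal_sup [set (phi x * (1 - x * q al x))%:E | x in `[0%R, M]%classic]
       <= (C * phi al)%:E)%E.

(* sum_k lam_k g(lam_k)^2, the variance of g(T^*T) T^*Z *)
Definition filter_var (R : realType) (lam : nat -> R) (g : R -> R) : R :=
  limn (series (fun k => lam k * g (lam k) ^+ 2)).

Definition candidate_sequence (R : realType) (A : set R) (lam : nat -> R)
    (q : R -> R -> R) (theta1 theta2 : R) (alpha : nat -> R) : Prop :=
  [/\ 1 < theta1,
      theta1 <= theta2,
      forall m, A (alpha m),
      forall m, alpha m.+1 < alpha m
    & forall m, theta1 <=
        filter_var lam (q (alpha m.+1)) / filter_var lam (q (alpha m))
        <= theta2].

(* minimum of a nonempty set of natural numbers (0 for the empty set) *)
Definition min_nat (N : set nat) : nat :=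
  xget 0%N [set n | N n /\ forall k, N k -> (n <= k)%N].

Definition m_max (R : realType) (lam : nat -> R) (q : R -> R -> R)
    (alpha : nat -> R) (s : R) : nat :=
  min_nat [set m | (0 < m)%N /\ 1 <= s ^+ 2 * filter_var lam (q (alpha m))].

Definition noise_diff (R : realType) (X Y : completeNormedModType R)
    (ip : {dot X for idfun}) (lam : nat -> R) (e : nat -> X) (T : X -> Y)
    (q : R -> R -> R) (alpha : nat -> R) (W : Y -> R) (m1 m2 : nat) : R :=
  `|estimator ip lam e T (q (alpha m1)) W
    - estimator ip lam e T (q (alpha m2)) W|.

(* Only x > 0 is required: for x < 0 no quantile can exist. *)
Definition noise_quantiles (R : realType) (X Y : completeNormedModType R)
    (ip : {dot X for idfun}) (lam : nat -> R) (e : nat -> X) (T : X -> Y)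
    (q : R -> R -> R) (alpha : nat -> R) (d : measure_display)
    (Omega : measurableType d) (P : probability Omega R)
    (Z : Y -> {RV P >-> R}) (z : nat -> nat -> R -> R) : Prop :=
  forall m1 m2 x, (m1 < m2)%N -> 0 < x ->
    P [set w | z m1 m2 x < noise_diff ip lam e T q alpha (Z ^~ w) m1 m2]
      = (expR (- x))%:E.

Definition solit_level (R : realType) (lam : nat -> R) (q : R -> R -> R)
    (alpha : nat -> R) (gamma s : R) (m : nat) : R :=
  let v k := s ^+ 2 * filter_var lam (q (alpha k)) in
  2 * (1 + gamma) * ln (v m.+1 / v 0%N).

Definition solit_threshold (R : realType) (lam : nat -> R) (q : R -> R -> R)
    (alpha : nat -> R) (z : nat -> nat -> R -> R) (beta gamma s : R)
    (m1 m2 : nat) : R :=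
  s * z m1 m2 (solit_level lam q alpha gamma s m1)
  + beta * Num.sqrt
      (s ^+ 2 * filter_var lam (fun x => q (alpha m1) x - q (alpha m2) x)).

Definition solit_index (R : realType) (X Y : completeNormedModType R)
    (ip : {dot X for idfun}) (lam : nat -> R) (e : nat -> X) (T : X -> Y)
    (q : R -> R -> R) (alpha : nat -> R) (z : nat -> nat -> R -> R)
    (beta gamma s : R) (W : Y -> R) : nat :=
  let fhat m := estimator ip lam e T (q (alpha m)) W in
  let M := m_max lam q alpha s in
  min_nat [set m1 | (m1 <= M)%N /\
    forall m2, (m1 < m2 <= M)%N ->
      `|fhat m1 - fhat m2|
        <= solit_threshold lam q alpha z beta gamma s m1 m2].

Definition solit_estimator (R : realType) (X Y : completeNormedModType R)
    (ip : {dot X for idfun}) (lam : nat -> R) (e : nat -> X) (T : X -> Y)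
    (q : R -> R -> R) (alpha : nat -> R) (z : nat -> nat -> R -> R)
    (beta gamma s : R) (W : Y -> R) : X :=
  let mhat := solit_index ip lam e T q alpha z beta gamma s W in
  estimator ip lam e T (q (alpha mhat)) W.

(* Main.v *)
(** The noise energies [|q_m(T^*T) T^*Z|^2] are quadratic forms [sum_k t_k xi_k^2] in the uncorrelated Gaussian variables [xi_k = Z (T e_k)]. Their exponential moments are bounded by [exp (2 sum_k t_k lam_k)] as soon as [t_k lam_k <= 1/4], so a quantile [z] of level [exp (- x)] satisfies [z^2 <= 2 V + 4 x mu], with [V] the trace and [mu] the largest eigenvalue of the covariance. Since [mu] is at most of order [1 / alpha] while [V] is at least of order [alpha^(- 1 - 1/a)], the logarithmic levels [x_m] are absorbed and every SOLIT threshold below [m] is of order [sqrt (v_m)].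

    Let [ms] be the first index at which the worst-case squared bias [(C phi (alpha_m) rho)^2] falls below a small multiple of [v_m]. If the rule stops before [ms], it is within a threshold of the estimator at [ms]; if it stops at [m > ms], some noise increment starting at [m - 1] has exceeded its quantile, which has so small a probability that these events contribute only [O (sigma^2 m_max^2)]. Hence the risk is of order [v_ms], and [v_ms] is evaluated with [V (alpha) <= C alpha^(- 1 - 1/a)], which follows from the polynomial eigenvalue decay. *)

Require Import Defs.
From HB Require Import structures.
From mathcomp Require Import all_boot all_order all_algebra.
From mathcomp Require Import all_classical all_reals all_analysis.
From mathcomp Require Import measurable_realfun.
From mathcomp Require Import ring lra.

Set Implicit Arguments.
Unset Strict Implicit.
Unset Printing Implicit Defensive.

Import Order.TTheory GRing.Theory Num.Theory.
Import numFieldNormedType.Exports.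

Local Open Scope classical_set_scope.
Local Open Scope ring_scope.

(** * Gaussian exponential moments *)

(** The small multiple in the choice of [ms] is [beta^2] times a constant [c] with
    [V_{m1,m2} >= c V_{m1}], which exists because the variances grow at least by the factor
    [theta1 > 1]. From [ms] on, every bias increment then fits into the summand
    [beta sqrt(v_{m1,m2})] of the threshold, so that only the noise can cause a rejection.

    The levels [x_m] give the exceedance probability [(V_0 / V_{m+1})^(2 (1 + gamma))], against
    noise of size [V_{m+1}] at the accepted index: each pair of indices costs [O (sigma^2 V_0)]. As
    the variances grow geometrically, [m_max] is logarithmic in [sigma], and the squared logarithm
    is negligible because the rate has exponent [2 nu / (2 nu + 1 + 1/a) < 1].

    The truth enters only through its bias at [ms], which is bounded over the whole source set; this
    makes the result uniform. Since [T^* Z] exists only almost surely and the loss need not be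
    measurable, expectations are compared with measurable majorants off a null set. *)

Section normal_integrals.
Local Open Scope ereal_scope.
Context {R : realType}.
Notation leb := (@lebesgue_measure R).

(** The Radon-Nikodym derivative of [normal_prob] and the function [normal_pdf] have the same
    integral over every measurable set, hence agree almost everywhere. *)
Lemma ge0_integral_normal_prob (m s : R) (f : R -> \bar R) :
  (forall x, 0 <= f x) -> measurable_fun [set: R] f ->
  \int[normal_prob m s]_x f x = \int[leb]_x (f x * (normal_pdf m s x)%:E).
Proof.
move=> f0 mf; have dom := @normal_prob_dominates R m s.
rewrite -(Radon_Nikodym_SigmaFinite.change_of_variables dom)//.
have RNi := Radon_Nikodym_SigmaFinite.f_integrable dom.
apply: ae_eq_integral => //.
- by apply: emeasurable_funM => //; exact: measurable_int RNi.
- apply: emeasurable_funM => //; apply/measurable_EFinP.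
  exact: measurable_normal_pdf.
- apply: ae_eqe_mul2l; apply: integral_ae_eq => //.
  + by apply/measurable_EFinP; exact: measurable_normal_pdf.
  + by move=> E _ mE; rewrite -Radon_Nikodym_SigmaFinite.f_integral.
Qed.

Let mpdf (m s : R) :
  measurable_fun [set: R] (fun x => (normal_pdf m s x)%:E).
Proof. by apply/measurable_EFinP; exact: measurable_normal_pdf. Qed.

Let pdf0 (m s x : R) : setT x -> 0 <= (normal_pdf m s x)%:E.
Proof. by move=> _; rewrite lee_fin normal_pdf_ge0. Qed.

(** Completing the square: the tilted density is a constant times the normal density with mean
    [m + u s^2]. *)
Lemma normal_expR_linear (m s u : R) : s != 0%R ->
  \int[normal_prob m s]_x (expR (u * x))%:E =
  (expR (u * m + u ^+ 2 * s ^+ 2 / 2))%:E.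
Proof.
move=> s0; rewrite ge0_integral_normal_prob; last 2 first.
- by move=> x; rewrite lee_fin expR_ge0.
- by apply/measurable_EFinP; apply: measurableT_comp => //; exact: measurable_funM.
rewrite -[RHS]mule1 -(integral_normal_pdf (m + u * s ^+ 2) s).
apply: etrans; last exact: (ge0_integralZl_EFin leb measurableT (@pdf0 _ _)
  (@mpdf _ _) (expR_ge0 _)).
apply: eq_integral => x _; rewrite -!EFinM; congr EFin.
rewrite !normal_pdfE// /normal_fun !(mulrCA _ (normal_peak s)) -!expRD.
by congr (_ * expR _)%R; field.
Qed.

(** With [D = 1 - 2 t s^2], the integrand is [1 / sqrt D] times the centered normal density of scale
    [s / sqrt D]. *)
Lemma normal_expR_sqr (s t : R) : s != 0%R -> (0 < 1 - 2 * t * s ^+ 2)%R ->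
  \int[normal_prob 0 s]_x (expR (t * x ^+ 2))%:E =
  ((Num.sqrt (1 - 2 * t * s ^+ 2))^-1)%:E.
Proof.
move=> s0 D0; set D := (1 - _)%R in D0 *.
rewrite ge0_integral_normal_prob; last 2 first.
- by move=> x; rewrite lee_fin expR_ge0.
- apply/measurable_EFinP; apply: measurableT_comp => //.
  by apply: measurable_funM => //; exact: measurable_funX.
have sD0 : (0 < Num.sqrt D)%R by rewrite sqrtr_gt0.
have s20 : (0 < s ^+ 2)%R by rewrite exprn_even_gt0.
pose r := (s / Num.sqrt D)%R.
have r0 : r != 0%R by rewrite mulf_neq0// invr_neq0// gt_eqF.
have r2 : (r ^+ 2 = s ^+ 2 / D)%R by rewrite exprMn exprVn sqr_sqrtr// ltW.
rewrite -[RHS]mule1 -(integral_normal_pdf 0 r).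
have isD0 : (0 <= (Num.sqrt D)^-1)%R by rewrite invr_ge0 ltW.
apply: etrans; last exact: (ge0_integralZl_EFin leb measurableT (@pdf0 _ _)
  (@mpdf _ _) isD0).
apply: eq_integral => x _; rewrite -!EFinM; congr EFin.
rewrite !normal_pdfE// /normal_fun !(mulrCA _ (normal_peak _)) -!expRD mulrA.
congr (_ * expR _)%R.
  rewrite /normal_peak r2 -invfM; congr (_^-1)%R.
  rewrite -sqrtrM; last first.
    by rewrite mulrn_wge0// mulr_ge0 ?pi_ge0// divr_ge0 ?ltW.
  by congr Num.sqrt; rewrite !mulr2n; field; rewrite ?gt_eqF.
rewrite r2 subr0 !mulr2n /D; field.
by rewrite -/D !gt_eqF// addr_gt0.
Qed.

End normal_integrals.

Section centered_gaussian.
Local Open Scope ereal_scope.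
Context {R : realType} d (Omega : measurableType d) (P : probability Omega R).

(** [is_gaussian] admits a Dirac mass at scale [0]. Both formulas stay true there, so that later
    arguments need not separate the degenerate case. *)
Lemma gaussian_integrals (X : {RV P >-> R}) : is_gaussian P X ->
  exists m s : R,
    (forall u : R, \int[P]_w (expR (u * X w))%:E =
                   (expR (u * m + u ^+ 2 * s ^+ 2 / 2))%:E) /\
    (m = 0%R -> forall t : R, (0 < 1 - 2 * t * s ^+ 2)%R ->
       \int[P]_w (expR (t * X w ^+ 2))%:E =
       ((Num.sqrt (1 - 2 * t * s ^+ 2))^-1)%:E).
Proof.
move=> [m [s hX]]; exists m, s.
have mexp u : measurable_fun [set: R] (fun x => (expR (u * x))%:E).
  by apply/measurable_EFinP; apply: measurableT_comp => //; exact: measurable_funM.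
have msqr t : measurable_fun [set: R] (fun x => (expR (t * x ^+ 2))%:E).
  apply/measurable_EFinP; apply: measurableT_comp => //.
  by apply: measurable_funM => //; exact: measurable_funX.
have pushX (f : R -> \bar R) : measurable_fun [set: R] f ->
    (forall x, 0 <= f x) ->
    \int[P]_w f (X w) = if s == 0%R then f m else \int[normal_prob m s]_x f x.
  move=> mf f0.
  have mX : @measurable_fun _ _ Omega (measurableTypeR R) setT X.
    exact: (@measurable_funPT _ _ _ _ X).
  have [s0|s0] := eqVneq s 0%R.
    rewrite -[LHS](ge0_integral_distribution X mf f0).
    rewrite -[RHS]mul1e -(diracT R m) -integral_dirac//.
    apply: (@eq_measure_integral _ _ _ setT (\d_m) (distribution P X) f).
    by move=> B mB _; rewrite -[LHS]/(P (X @^-1` B)) hX// s0 eqxx.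
  have := @ge0_integral_pushforward _ _ Omega (measurableTypeR R) R X mX P setT f.
  rewrite preimage_setT => <- //.
  have := @eq_measure_integral _ _ _ setT (normal_prob m s) _ f.
  apply.
  by move=> B mB _; rewrite -[LHS]/(P (X @^-1` B)) hX// (negbTE s0).
split=> [u|m0 t t0].
  rewrite (pushX _ (mexp u)); last by move=> x; rewrite lee_fin expR_ge0.
  have [->|s0] := eqVneq s 0%R; last exact: normal_expR_linear.
  by rewrite expr0n/= mulr0 mul0r addr0.
rewrite (pushX _ (msqr t)); last by move=> x; rewrite lee_fin expR_ge0.
have [s0|s0] := eqVneq s 0%R; last by rewrite m0; exact: normal_expR_sqr.
by rewrite s0 m0 expr0n/= !mulr0 expR0 subr0 sqrtr1 invr1.
Qed.

Lemma sqr_integral_integrable (X : {RV P >-> R}) (v : R) :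
  \int[P]_w (X w ^+ 2)%:E = v%:E -> P.-integrable setT (EFin \o X).
Proof.
move=> EX2; have mX : measurable_fun [set: Omega] (X : Omega -> R) by [].
have mX2 : measurable_fun [set: Omega] (fun w => (X w ^+ 2)%:E).
  by apply/measurable_EFinP; exact: measurable_funX.
have iX2 : P.-integrable setT (fun w => (X w ^+ 2)%:E).
  apply/integrableP; split=> //.
  by under eq_integral do rewrite gee0_abs ?lee_fin ?sqr_ge0//; rewrite EX2 ltry.
have i1 : P.-integrable setT (EFin \o cst 1%R).
  exact: finite_measure_integrable_cst.
apply: le_integrable (integrableD measurableT i1 iX2) => //.
  exact/measurable_EFinP.
move=> w _; change (`|X w|%:E <= `|1 + X w ^+ 2|%:E).
rewrite lee_fin [leRHS]ger0_norm ?addr_ge0 ?sqr_ge0//.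
rewrite -[(X w ^+ 2)%R]real_normK ?num_real//.
by have := sqr_ge0 (`|X w| - 1)%R; have := normr_ge0 (X w); nra.
Qed.

(* Both parameters of the law come from elementary inequalities: [1 + u X <= exp (u X)] forces the mean to vanish, and [1 - t X^2 <= exp (- t X^2)] bounds the squared scale by the second moment. *)
Lemma centered_gaussian_mgf (X : {RV P >-> R}) (v : R) :
    is_gaussian P X -> 'E_P[X] = 0 -> \int[P]_w (X w ^+ 2)%:E = v%:E ->
  forall u : R, \int[P]_w (expR (u * X w))%:E <= (expR (u ^+ 2 * v / 2))%:E.
Proof.
move=> /gaussian_integrals[m [s [mgf sqr]]] EX EX2.
have mX : measurable_fun [set: Omega] (X : Omega -> R) by [].
have v0 : (0 <= v)%R.
  by rewrite -lee_fin -EX2; apply: integral_ge0 => w _; rewrite lee_fin sqr_ge0.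
have iX : P.-integrable setT (EFin \o X) by exact: sqr_integral_integrable EX2.
have mexp u : measurable_fun [set: Omega] (fun x => (expR (u * X x))%:E).
  by apply/measurable_EFinP; apply: measurableT_comp => //; exact: measurable_funM.
have m0 : m = 0%R.
  have ge0 u : (0 <= u * m + u ^+ 2 * s ^+ 2 / 2)%R.
    rewrite -ler_expR expR0 -lee_fin -mgf.
    have i1 : P.-integrable setT (EFin \o cst 1%R).
      exact: finite_measure_integrable_cst.
    have iu : P.-integrable setT (EFin \o (fun w => u * X w)%R).
      exact: (integrableZl measurableT u iX).
    rewrite (_ : 1%:E = \int[P]_w ((cst 1 w)%:E + (u * X w)%:E)).
      apply: le_integral => //.
      - exact: (integrableD _ i1 iu).
      - apply/integrableP; split=> //.
        under eq_integral do rewrite gee0_abs ?lee_fin ?expR_ge0//.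
        by rewrite mgf ltry.
      - by move=> w _; rewrite -EFinD lee_fin expR_ge1Dx.
    rewrite (integralD_EFin measurableT i1 iu).
    have -> : \int[P]_w (EFin \o cst 1%R) w = 1.
      by have := expectation_cst P 1%R; rewrite unlock.
    rewrite [X in _ + X](_ : _ = u%:E * \int[P]_w (X w)%:E).
      by rewrite -expectation_def EX mule0 adde0.
    exact: (integralZl measurableT iX u).
  (* Close to the minimizer of the quadratic in [u]; the [+ 1] keeps the denominator positive when
     [s = 0]. *)
  have := ge0 (- m / (s ^+ 2 + 1))%R.
  have s1 : (0 < s ^+ 2 + 1)%R by rewrite ltr_pwDr// sqr_ge0.
  rewrite (_ : _ + _ = - (m / (s ^+ 2 + 1)) ^+ 2 * (s ^+ 2 / 2 + 1))%R; last first.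
    by field; rewrite gt_eqF.
  rewrite mulNr oppr_ge0 pmulr_lle0; last by rewrite ltr_pwDr// divr_ge0// sqr_ge0.
  move=> h; have : ((m / (s ^+ 2 + 1)) ^+ 2 = 0)%R by apply/eqP; rewrite eq_le h sqr_ge0.
  by move/eqP; rewrite sqrf_eq0 mulf_eq0 invr_eq0 (gt_eqF s1) orbF => /eqP.
have sv : (s ^+ 2 <= v)%R.
  rewrite leNgt; apply/negP => vs.
  have s20 : (0 < s ^+ 2)%R by exact: le_lt_trans vs.
  pose D := (v * s ^+ 2 + 1)%R.
  have D0 : (0 < D)%R by rewrite ltr_pwDr// mulr_ge0// ltW.
  (* Chosen small enough for a contradiction: after division by [t], the only negative second-order
     term of [(1 - t v)^2 (1 + 2 t s^2) - 1] is [- 4 t v s^2], and [4 t D = s^2 - v] keeps it below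
     half of the leading term [2 (s^2 - v)]. *)
  pose t := ((s ^+ 2 - v) / (4 * D))%R.
  have t0 : (0 < t)%R by rewrite divr_gt0 ?subr_gt0// mulr_gt0.
  have Q0 : (1 < 1 + 2 * t * s ^+ 2)%R by rewrite ltrDl mulr_gt0// mulr_gt0.
  have h : (1 <= t * v + (Num.sqrt (1 + 2 * t * s ^+ 2))^-1)%R.
    rewrite -lee_fin EFinD EFinM -EX2.
    have := sqr m0 (- t)%R; rewrite mulrN mulNr opprK => <-; last by rewrite (lt_trans _ Q0).
    have mX2 : measurable_fun [set: Omega] (fun w => (X w ^+ 2)%:E).
      by apply/measurable_EFinP; exact: measurable_funX.
    have mtX2 : measurable_fun [set: Omega] (fun w => t%:E * (X w ^+ 2)%:E).
      exact: measurable_funeM.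
    have mE : measurable_fun [set: Omega] (fun w => (expR (- t * X w ^+ 2))%:E).
      apply/measurable_EFinP; apply: measurableT_comp => //.
      by apply: measurable_funM => //; exact: measurable_funX.
    have X2ge0 w : setT w -> 0 <= (X w ^+ 2)%:E by rewrite lee_fin sqr_ge0.
    have tX2ge0 w : setT w -> 0 <= t%:E * (X w ^+ 2)%:E.
      by move=> ?; rewrite mule_ge0 ?X2ge0// lee_fin ltW.
    have Ege0 w : setT w -> 0 <= (expR (- t * X w ^+ 2))%:E.
      by rewrite lee_fin expR_ge0.
    rewrite -(ge0_integralZl_EFin P measurableT X2ge0 mX2 (ltW t0)).
    rewrite -(ge0_integralD P measurableT tX2ge0 mtX2 Ege0 mE).
    rewrite -[leLHS](_ : \int[P]_w (1%R)%:E = _); last first.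
      by have := expectation_cst P 1%R; rewrite unlock.
    apply: ge0_le_integral => //.
    - exact: emeasurable_funD.
    - move=> w _; rewrite -EFinM -EFinD lee_fin mulNr.
      by have := expR_ge1Dx (- (t * X w ^+ 2)); lra.
  have tv1 : (t * v <= 1)%R.
    rewrite /t mulrAC ler_pdivrMr ?mulr_gt0// mul1r /D.
    have := mulr_ge0 v0 v0; have : (0 <= v * s ^+ 2)%R by rewrite mulr_ge0// ltW.
    by nra.
  have {}h : ((1 - t * v) ^+ 2 * (1 + 2 * t * s ^+ 2) <= 1)%R.
    have Q1 : (0 < Num.sqrt (1 + 2 * t * s ^+ 2))%R.
      by rewrite sqrtr_gt0 (lt_trans _ Q0).
    rewrite -[X in (_ * X <= _)%R]sqr_sqrtr; last by rewrite (le_trans _ (ltW Q0)).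
    rewrite -exprMn expr_le1//; last by rewrite mulr_ge0 ?subr_ge0// ltW.
    by rewrite -ler_pdivlMr// mul1r lerBlDl.
  have tD : (4 * t * D = s ^+ 2 - v)%R by rewrite /t; field; rewrite gt_eqF.
  have : (0 <= t * v ^+ 2 + 2 * t ^+ 2 * v ^+ 2 * s ^+ 2)%R.
    by have := mulr_ge0 (ltW t0) (sqr_ge0 v); have := sqr_ge0 (t * v * s)%R; lra.
  move: h tD; rewrite /D; set S := (s ^+ 2)%R in vs s20 *.
  move=> h tD; have := mulr_gt0 t0 (_ : 0 < S - v)%R; rewrite subr_gt0 => /(_ vs).
  by nra.
move=> u; rewrite mgf m0 mulr0 add0r lee_fin ler_expR.
by rewrite ler_pM2r// ler_wpM2l// sqr_ge0.
Qed.

End centered_gaussian.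

(** * Linear and quadratic forms in uncorrelated Gaussian variables *)

Section orthogonal_gaussians.
Local Open Scope ereal_scope.
Context {R : realType} d (Omega : measurableType d) (P : probability Omega R).
Variables (xi : nat -> {RV P >-> R}) (lam : nat -> R).
Hypothesis xi_gauss : forall (n : nat) (c : 'I_n -> R),
  is_gaussian P (fun w => \sum_(i < n) c i * xi i w)%R.
Hypothesis xi_center : forall k, 'E_P[xi k] = 0.
Hypothesis xi_cov : forall j k,
  covariance P (xi j) (xi k) = (lam k * (j == k)%:R)%:E.

Let mxi k : measurable_fun [set: Omega] (xi k : Omega -> R).
Proof. by []. Qed.

Lemma orthogonal_integralM j k :
  \int[P]_w (xi j w * xi k w)%:E = (lam k * (j == k)%:R)%:E.
Proof.
rewrite -xi_cov unlock !xi_center unlock; apply: eq_integral => w _.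
by congr EFin; change (xi j w * xi k w = (xi j w - 0) * (xi k w - 0))%R; rewrite !subr0.
Qed.

Let int_sqr k : \int[P]_w (xi k w ^+ 2)%:E = (lam k)%:E.
Proof.
by under eq_integral do rewrite expr2; rewrite orthogonal_integralM eqxx mulr1.
Qed.

Let lam_ge0 k : (0 <= lam k)%R.
Proof.
by rewrite -lee_fin -int_sqr integral_ge0// => w _; rewrite lee_fin sqr_ge0.
Qed.

Let integrable_sqr k : P.-integrable setT (fun w => (xi k w ^+ 2)%:E).
Proof.
apply/integrableP; split; first by apply/measurable_EFinP; exact: measurable_funX.
under eq_integral do rewrite gee0_abs ?lee_fin ?sqr_ge0//.
by rewrite int_sqr ltry.
Qed.

Let integrable_mul j k : P.-integrable setT (fun w => (xi j w * xi k w)%:E).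
Proof.
apply: le_integrable (integrableD measurableT (integrable_sqr j) (integrable_sqr k)) => //.
  by apply/measurable_EFinP; exact: measurable_funM.
move=> w _; change (`|xi j w * xi k w|%:E <= `|xi j w ^+ 2 + xi k w ^+ 2|%:E).
rewrite lee_fin [leRHS]ger0_norm ?addr_ge0 ?sqr_ge0// ler_norml.
have := sqr_ge0 (xi j w + xi k w)%R; have := sqr_ge0 (xi j w - xi k w)%R.
by have := sqr_ge0 (xi j w); have := sqr_ge0 (xi k w); nra.
Qed.

(** A linear form in the [xi k] is Gaussian by [xi_gauss], and uncorrelatedness gives its variance;
    the one-variable bound then applies to it, without factorizing the joint law. *)
Lemma orthogonal_mgf (n : nat) (c : nat -> R) :
  \int[P]_w (expR (\sum_(0 <= k < n) c k * xi k w))%:E <=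
  (expR (\sum_(0 <= k < n) c k ^+ 2 * lam k / 2))%:E.
Proof.
pose L : Omega -> R := fun w => (\sum_(i < n) c i * xi i w)%R.
have mL : measurable_fun [set: Omega] L.
  by apply: measurable_sum => i; exact: measurable_funM.
pose isL := isMeasurableFun.Build _ _ _ _ L mL.
pose LX : {RV P >-> R} := HB.pack L isL.
have ixi k := sqr_integral_integrable (int_sqr k).
have EL : 'E_P[LX] = 0.
  rewrite unlock.
  under eq_integral do rewrite -sumEFin.
  rewrite (integral_sum measurableT (f := fun (i : 'I_n) w => (c i * xi i w)%:E)); last first.
    by move=> i; exact: (integrableZl measurableT (c i) (ixi i)).
  rewrite big1// => i _; under eq_integral do rewrite EFinM.
  rewrite (integralZl measurableT (ixi i)).
  by have := xi_center i; rewrite unlock => ->; rewrite mule0.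
have EL2 : \int[P]_w (LX w ^+ 2)%:E = (\sum_(i < n) c i ^+ 2 * lam i)%:E.
  transitivity (\int[P]_w \sum_(i < n) \sum_(j < n)
      ((c i * c j)%:E * (xi i w * xi j w)%:E)).
    apply: eq_integral => w _; rewrite /LX/= /L expr2 mulr_suml -sumEFin.
    apply: eq_bigr => i _; rewrite mulr_sumr -sumEFin; apply: eq_bigr => j _.
    by rewrite -EFinM; congr EFin; ring.
  have ic i j : P.-integrable setT (fun w => (c i * c j)%:E * (xi i w * xi j w)%:E).
    exact: integrableZl.
  rewrite integral_sum//=; last by move=> i; exact: integrable_sum.
  rewrite -sumEFin; apply: eq_bigr => i _; rewrite integral_sum//=.
  rewrite (bigD1 i)//= big1 => [|j ji].
    by rewrite integralZl// orthogonal_integralM eqxx mulr1 adde0 -EFinM expr2.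
  by rewrite integralZl// orthogonal_integralM eq_sym val_eqE (negbTE ji) mulr0 mule0.
have := centered_gaussian_mgf (xi_gauss (fun i : 'I_n => c i) : is_gaussian P LX) EL EL2 1.
rewrite expr1n mul1r mulr_suml big_mkord; apply: le_trans.
rewrite le_eqVlt; apply/orP; left; apply/eqP; apply: eq_integral => w _.
by rewrite mul1r big_mkord.
Qed.

(** After squaring, [1 + 4 y <= exp (4 y)] reduces the claim to [(1 + 4 y) (1 - 2 y) >= 1], that is
    [y (1 - 4 y) >= 0]. This is the origin of the bound [1/4] on [t k * lam k]. *)
Lemma sqrt_inv_le_expR (y : R) : (0 <= y <= 4^-1)%R ->
  ((Num.sqrt (1 - 2 * y))^-1 <= expR (2 * y))%R.
Proof.
move=> /andP[y0 y1]; have D0 : (0 < 1 - 2 * y)%R by lra.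
rewrite -[leLHS]mul1r ler_pdivrMr ?sqrtr_gt0//.
rewrite -[leRHS]ger0_norm ?mulr_ge0 ?expR_ge0 ?sqrtr_ge0//.
rewrite -sqrtr_sqr -[leLHS]sqrtr1 ler_wsqrtr// exprMn sqr_sqrtr ?(ltW D0)// -expRM_natl.
have := expR_ge1Dx (2%:R * (2 * y))%R => h.
apply: (@le_trans _ _ ((1 + 4 * y) * (1 - 2 * y))%R); last by rewrite ler_pM2r//; lra.
have : (0 <= y * (4^-1 - y))%R by rewrite mulr_ge0// subr_ge0.
by lra.
Qed.

(* Linearization: [exp (t x^2)] is the mean of [exp (sqrt (2 t) g x)] over a standard normal [g], so that only the law of linear forms is needed. *)
Lemma orthogonal_sqr_mgf_aux (N : nat) (t : nat -> R) :
  (forall k, 0 <= t k)%R -> (forall k, t k * lam k <= 4^-1)%R ->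
  forall n (c : nat -> R), (n <= N)%N ->
  \int[P]_w (expR (\sum_(0 <= k < n) t k * xi k w ^+ 2 +
                   \sum_(n <= k < N) c k * xi k w))%:E <=
  (expR (\sum_(0 <= k < n) 2 * (t k * lam k) +
         \sum_(n <= k < N) c k ^+ 2 * lam k / 2))%:E.
Proof.
(* The induction is on the number of squared coordinates, for all coefficients [c] of the linear
   ones: the square of [xi n] is traded for a linear term with coefficient [sqrt (2 t_n) g], and the
   induction hypothesis is used at each fixed [g]. *)
move=> t0 tlam; elim=> [|n IHn] c nN.
  rewrite [in leRHS]big_geq// add0r; apply: le_trans (orthogonal_mgf N c).
  by under eq_integral do rewrite big_geq// add0r.
pose N01 := (@normal_prob R 0 1 : {sigma_finite_measure set (measurableTypeR R) -> \bar R}).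
pose c' (g : R) k := if k == n then (Num.sqrt (2 * t n) * g)%R else c k.
pose f (p : Omega * measurableTypeR R) : \bar R :=
  (expR (\sum_(0 <= k < n) t k * xi k p.1 ^+ 2 +
         \sum_(n <= k < N) c' p.2 k * xi k p.1))%:E.
have mf : measurable_fun setT f.
  apply/measurable_EFinP; apply: measurableT_comp => //.
  apply: measurable_funD; apply: measurable_sum => k.
    apply: measurable_funM => //; apply: measurable_funX.
    exact: (measurableT_comp (mxi k) measurable_fst).
  apply: measurable_funM; last exact: (measurableT_comp (mxi k) measurable_fst).
  rewrite /c'; case: (k == n) => //; apply: measurable_funM => //.
have f0 p : 0 <= f p by rewrite lee_fin expR_ge0.
have sumE (F : nat -> R) : (\sum_(n <= k < N) F k = F n + \sum_(n.+1 <= k < N) F k)%R.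
  by rewrite big_ltn.
have c'E g (F : nat -> R -> R) :
    (\sum_(n.+1 <= k < N) F k (c' g k) = \sum_(n.+1 <= k < N) F k (c k))%R.
  apply: eq_big_nat => k /andP[nk _]; rewrite /c' gtn_eqF//.
have s2t : (Num.sqrt (2 * t n) ^+ 2 = 2 * t n)%R by rewrite sqr_sqrtr// mulr_ge0.
have e0 (h : measurableTypeR R -> R) g : setT g -> 0 <= (expR (h g))%:E.
  by rewrite lee_fin expR_ge0.
have fubini := @fubini_tonelli _ _ _ _ _ P N01 f mf f0.
rewrite (_ : \int[P]_w _ = \int[P]_w \int[N01]_g f (w, g)); last first.
  apply: eq_integral => w _.
  set B := (\sum_(n.+1 <= k < N) c k * xi k w)%R.
  set A := (\sum_(0 <= k < n) t k * xi k w ^+ 2)%R.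
  rewrite big_nat_recr//= -/A.
  transitivity (\int[N01]_g
    ((expR (A + B))%:E * (expR (Num.sqrt (2 * t n) * xi n w * g))%:E)).
    have me : @measurable_fun _ _ (measurableTypeR R) _ setT
        (fun g => (expR (Num.sqrt (2 * t n) * xi n w * g))%:E).
      by apply/measurable_EFinP; apply: measurableT_comp => //; exact: measurable_funM.
    rewrite (ge0_integralZl_EFin N01 measurableT (e0 _) me (expR_ge0 _)).
    rewrite normal_expR_linear ?oner_eq0// -EFinM -expRD; congr (expR _)%:E.
    by rewrite mulr0 add0r expr1n mulr1 exprMn s2t; field.
  apply: eq_integral => g _; rewrite /f/= -EFinM -expRD; congr (expR _)%:E.
  rewrite sumE (c'E g (fun k x => x * xi k w)%R) -/A -/B /c' eqxx; ring.
rewrite fubini.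
have mexp : measurable_fun setT (fun g : measurableTypeR R => (expR ((t n * lam n) * g ^+ 2))%:E).
  apply/measurable_EFinP; apply: measurableT_comp => //.
  by apply: measurable_funM => //; exact: measurable_funX.
set A := (\sum_(0 <= k < n) 2 * (t k * lam k))%R.
set B := (\sum_(n.+1 <= k < N) c k ^+ 2 * lam k / 2)%R.
apply: (@le_trans _ _ (\int[N01]_g
    ((expR (A + B))%:E * (expR ((t n * lam n) * g ^+ 2))%:E))).
  apply: ge0_le_integral => //.
  - by move=> g _; apply: integral_ge0.
  - exact: measurable_fun_fubini_tonelli_G.
  - exact: measurable_funeM.
  - move=> g _; apply: le_trans (IHn (c' g) (ltnW nN)) _.
    rewrite -EFinM -expRD lee_fin ler_expR -/A.
    rewrite sumE (c'E g (fun k x => x ^+ 2 * lam k / 2)%R) -/B /c' eqxx.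
    by rewrite exprMn s2t le_eqVlt; apply/orP; left; apply/eqP; field.
have ytn : (0 <= t n * lam n <= 4^-1)%R by rewrite mulr_ge0//=.
rewrite (ge0_integralZl_EFin N01 measurableT (e0 _) mexp (expR_ge0 _)).
rewrite normal_expR_sqr ?oner_eq0//; last by rewrite expr1n mulr1; lra.
rewrite big_nat_recr//= -/A -EFinM lee_fin (addrAC A) [leRHS]expRD.
rewrite (ler_pM2l (expR_gt0 (A + B))).
by rewrite expr1n mulr1 sqrt_inv_le_expR.
Qed.

Lemma orthogonal_sqr_mgf (n : nat) (t : nat -> R) :
  (forall k, 0 <= t k)%R -> (forall k, t k * lam k <= 4^-1)%R ->
  \int[P]_w (expR (\sum_(0 <= k < n) t k * xi k w ^+ 2))%:E <=
  (expR (\sum_(0 <= k < n) 2 * (t k * lam k)))%:E.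
Proof.
move=> t0 tlam; have := orthogonal_sqr_mgf_aux t0 tlam (fun=> 0%R) (leqnn n).
rewrite [X in (_ + X)%R]big_geq// addr0; apply: le_trans.
rewrite le_eqVlt; apply/orP; left; apply/eqP; apply: eq_integral => w _.
by rewrite [X in (_ + X)%R]big_geq// addr0.
Qed.

End orthogonal_gaussians.

Section nonnegative_series.
Context {R : realType}.
Implicit Types u v : nat -> R.

Lemma nd_series u : (forall k, 0 <= u k) ->
  {homo series u : n m / (n <= m)%N >-> n <= m}.
Proof. by move=> u0; apply: nondecreasing_series => k _ _. Qed.

Lemma le_series_lim u n : (forall k, 0 <= u k) -> cvgn (series u) ->
  \sum_(0 <= k < n) u k <= limn (series u).
Proof. by move=> u0 cu; exact: (nondecreasing_cvgn_le (nd_series u0) cu n). Qed.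

Lemma series_lim_ge0 u : (forall k, 0 <= u k) -> cvgn (series u) ->
  0 <= limn (series u).
Proof. by move=> u0 /(le_series_lim 0 u0); rewrite big_geq. Qed.

Lemma series_lim_le u C : cvgn (series u) ->
  (forall n, \sum_(0 <= k < n) u k <= C) -> limn (series u) <= C.
Proof. by move=> cu h; apply: limr_le => //; apply: nearW => n; exact: h. Qed.

Lemma bounded_series_cvg u C : (forall k, 0 <= u k) ->
  (forall n, \sum_(0 <= k < n) u k <= C) -> cvgn (series u).
Proof.
move=> u0 h; apply: nondecreasing_is_cvgn; first exact: nd_series.
by exists C => _ [n _ <-]; exact: h.
Qed.

Lemma series_lim_le_series u v : (forall k, u k <= v k) ->
  cvgn (series u) -> cvgn (series v) -> limn (series u) <= limn (series v).
Proof.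
move=> uv cu cv; apply: ler_lim => //; apply: nearW => n.
by apply: ler_sum => k _.
Qed.

Lemma nneseries_EFin u : cvgn (series u) ->
  (\sum_(0 <= k <oo) (u k)%:E)%E = (limn (series u))%:E.
Proof.
move=> cu; rewrite -EFin_lim//; congr (limn _); apply/funext => n /=.
by rewrite sumEFin.
Qed.

Lemma nneseries_lty_cvg u : (forall k, 0 <= u k) ->
  (\sum_(0 <= k <oo) (u k)%:E < +oo)%E -> cvgn (series u).
Proof.
move=> u0 h.
have s0 : (0 <= \sum_(0 <= k <oo) (u k)%:E)%E.
  by apply: nneseries_ge0 => k _ _; rewrite lee_fin.
apply: (@bounded_series_cvg _ (fine (\sum_(0 <= k <oo) (u k)%:E)%E)) => // n.
rewrite -lee_fin fineK ?ge0_fin_numE// -sumEFin.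
by apply: nneseries_lim_ge => k _ _; rewrite lee_fin.
Qed.

Lemma cvg_series_mul_bounded u v (K : R) : (forall k, 0 <= u k) ->
  (forall k, 0 <= v k <= K) -> cvgn (series u) ->
  cvgn (series (fun k => v k * u k)).
Proof.
move=> u0 vK cu; have K0 : 0 <= K by have /andP[v0 vK0] := vK 0%N; exact: le_trans vK0.
apply: (@bounded_series_cvg _ (K * limn (series u))) => [k|n].
  by rewrite mulr_ge0//; case/andP: (vK k).
apply: le_trans (ler_wpM2l K0 (le_series_lim n u0 cu)).
by rewrite mulr_sumr; apply: ler_sum => k _; rewrite ler_wpM2r//; case/andP: (vK k).
Qed.

End nonnegative_series.

(** * Gaussian series and the quantiles of their norms *)

Section gaussian_series.
Local Open Scope ereal_scope.
Context {R : realType} d (Omega : measurableType d) (P : probability Omega R).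
Variables (xi : nat -> {RV P >-> R}) (lam : nat -> R).
Hypothesis xi_gauss : forall (n : nat) (c : 'I_n -> R),
  is_gaussian P (fun w => \sum_(i < n) c i * xi i w)%R.
Hypothesis xi_center : forall k, 'E_P[xi k] = 0.
Hypothesis xi_cov : forall j k,
  covariance P (xi j) (xi k) = (lam k * (j == k)%:R)%:E.
Hypothesis lam_cvg : cvgn (series lam).

Let int_sqr k : \int[P]_w (xi k w ^+ 2)%:E = (lam k)%:E.
Proof.
under eq_integral do rewrite expr2.
by rewrite (orthogonal_integralM xi_center xi_cov) eqxx mulr1.
Qed.

Let lam_ge0 k : (0 <= lam k)%R.
Proof.
by rewrite -lee_fin -int_sqr integral_ge0// => w _; rewrite lee_fin sqr_ge0.
Qed.

Let msqr k : measurable_fun [set: Omega] (fun w => (xi k w ^+ 2)%:E).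
Proof. by apply/measurable_EFinP; exact: measurable_funX. Qed.

(** For [xi k = Z (T (e k))] this is the exceptional event on which [T^* Z] is not an element of the
    Hilbert space and [adjoint_process] takes its default value. *)
Definition divergence_set : set Omega :=
  [set w | ~ cvgn (series (fun k => xi k w ^+ 2)%R)].

Let series_xi w := \sum_(0 <= k <oo) (xi k w ^+ 2)%:E.

Let divergenceE : divergence_set = [set w | series_xi w = +oo].
Proof.
have x0 w k : (0 <= xi k w ^+ 2)%R by exact: sqr_ge0.
apply/seteqP; split=> w /=; rewrite /divergence_set/=.
  move=> h; apply/eqP; rewrite -leye_eq leNgt; apply/negP => hlt.
  by apply: h; exact: nneseries_lty_cvg.
by move=> h c; move: h; rewrite /series_xi nneseries_EFin.
Qed.

Let mseries : measurable_fun [set: Omega] series_xi.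
Proof.
apply: (@ge0_emeasurable_sum _ _ _ _ (fun k w => (xi k w ^+ 2)%:E) xpredT) => //.
by move=> k w _ _; rewrite lee_fin sqr_ge0.
Qed.

Lemma measurable_divergence_set : measurable divergence_set.
Proof.
rewrite divergenceE (_ : [set _ | _] = series_xi @^-1` [set +oo])//.
rewrite -[X in measurable X]setTI; exact: mseries.
Qed.

(** By Tonelli the mean of [sum_k xi_k^2] is the trace [sum_k lam_k], which is finite. *)
Lemma divergence_set_null : P divergence_set = 0.
Proof.
have x0 k w : 0 <= (xi k w ^+ 2)%:E by rewrite lee_fin sqr_ge0.
have int_fin : \int[P]_w series_xi w = (limn (series lam))%:E.
  rewrite integral_nneseries//; under eq_eseriesr do rewrite int_sqr.
  by rewrite nneseries_EFin.
have iS : P.-integrable setT series_xi.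
  apply/integrableP; split=> //; under eq_integral do rewrite gee0_abs ?nneseries_ge0//.
  by rewrite int_fin ltry.
have [N [mN N0 sub]] := integrable_ae measurableT iS.
apply/eqP; rewrite -measure_le0 -N0; apply: le_measure; rewrite ?inE//.
  exact: measurable_divergence_set.
by rewrite divergenceE => w /= wy; apply: sub => /= /(_ Logic.I); rewrite wy.
Qed.

(* The limit is taken in [\bar R], hence is measurable and defined even where the series diverges. *)
Definition exp_series (t : nat -> R) (w : Omega) : \bar R :=
  limn (fun n => (expR (\sum_(0 <= k < n) t k * xi k w ^+ 2))%:E).

Section exp_series.
Variable t : nat -> R.
Hypothesis t_ge0 : forall k, (0 <= t k)%R.
Hypothesis tlam : forall k, (t k * lam k <= 4^-1)%R.
Hypothesis tlam_cvg : cvgn (series (fun k => t k * lam k)%R).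

Let e_ n w : \bar R := (expR (\sum_(0 <= k < n) t k * xi k w ^+ 2))%:E.

Let mexp n : measurable_fun [set: Omega] (e_ n).
Proof.
apply/measurable_EFinP; apply: measurableT_comp => //.
by apply: measurable_sum => k; apply: measurable_funM => //; exact: measurable_funX.
Qed.

Let exp0 n w : setT w -> 0 <= e_ n w.
Proof. by rewrite lee_fin expR_ge0. Qed.

Let nd_exp w : setT w -> {homo e_^~ w : n m / (n <= m)%N >-> n <= m}.
Proof.
move=> _ n m nm; rewrite lee_fin ler_expR.
by apply: nd_series nm => k; rewrite mulr_ge0 ?sqr_ge0.
Qed.

Lemma exp_series_ge0 w : 0 <= exp_series t w.
Proof.
apply: lime_ge; first by apply: ereal_nondecreasing_is_cvgn; exact: nd_exp.
by apply: nearW => n; exact: exp0.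
Qed.

Lemma measurable_exp_series : measurable_fun [set: Omega] (exp_series t).
Proof.
apply: (emeasurable_fun_cvg e_) => // w _.
exact: (@ereal_nondecreasing_is_cvgn _ (e_^~ w) (nd_exp _)).
Qed.

Lemma integral_exp_series :
  \int[P]_w exp_series t w <= (expR (2 * limn (series (fun k => t k * lam k)%R)))%:E.
Proof.
rewrite monotone_convergence//; apply: lime_le.
  apply: ereal_nondecreasing_is_cvgn => n m nm.
  change (\int[P]_w e_ n w <= \int[P]_w e_ m w).
  apply: (ge0_le_integral P measurableT (@exp0 n) (mexp n) (mexp m)) => w _.
  exact: (@nd_exp w Logic.I n m nm).
apply: nearW => n; apply: le_trans (orthogonal_sqr_mgf xi_gauss xi_center xi_cov n t_ge0 tlam) _.
rewrite lee_fin ler_expR -mulr_sumr ler_wpM2l//.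
by apply: le_series_lim => // k; rewrite mulr_ge0.
Qed.

Lemma exp_seriesE w : cvgn (series (fun k => t k * xi k w ^+ 2)%R) ->
  exp_series t w = (expR (limn (series (fun k => t k * xi k w ^+ 2)%R)))%:E.
Proof.
move=> c; rewrite /exp_series; apply/cvg_lim => //.
apply: cvg_EFin; first by near=> n.
apply: (cvg_comp _ _ c); exact: continuous_expR.
Unshelve. all: by end_near. Qed.

End exp_series.

Section quantile.
Variables (N : Omega -> R) (g : nat -> R) (K c0 : R).
Hypothesis N_cvg : forall w, ~ divergence_set w ->
  N w = Num.sqrt (limn (series (fun k => g k ^+ 2 * xi k w ^+ 2)%R)).
Hypothesis N_dvg : forall w, divergence_set w -> N w = c0.
Hypothesis g_bounded : forall k, (g k ^+ 2 <= K)%R.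

Let cvg_gxi w : ~ divergence_set w ->
  cvgn (series (fun k => g k ^+ 2 * xi k w ^+ 2)%R).
Proof.
move=> /contrapT cxi; apply: (cvg_series_mul_bounded (K := K) _ _ cxi) => k.
  exact: sqr_ge0.
by rewrite sqr_ge0/=.
Qed.

(** [N] is described on two pieces: the root of a measurable series off the divergence set, the
    constant [c0] on it. Comparing squares is legitimate only for [z >= 0]; for negative [z] the
    first piece lies entirely in the tail. *)
Lemma measurable_noise_tail z : measurable [set w | (z < N w)%R].
Proof.
have mD := measurable_divergence_set.
have g0 k w : (0 <= g k ^+ 2 * xi k w ^+ 2)%R by rewrite mulr_ge0 ?sqr_ge0.
pose S w := \sum_(0 <= k <oo) (g k ^+ 2 * xi k w ^+ 2)%:E.
have mS : measurable_fun [set: Omega] S.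
  apply: (@ge0_emeasurable_sum _ _ _ _
    (fun k w => (g k ^+ 2 * xi k w ^+ 2)%:E) xpredT) => [k w _ _|k _].
    by rewrite lee_fin.
  by apply/measurable_EFinP; apply: measurable_funM => //; exact: measurable_funX.
pose A : set Omega := if (z < 0)%R then setT else [set w | (z ^+ 2)%:E < S w].
pose B : set Omega := if (z < c0)%R then setT else set0.
have mA : measurable A.
  rewrite /A; case: ifP => // _; rewrite -[X in measurable X]setTI.
  exact: emeasurable_fun_o_infty.
have mB : measurable B by rewrite /B; case: ifP.
rewrite (_ : [set _ | _] = (divergence_set `&` B) `|` (~` divergence_set `&` A)).
  by apply: measurableU; apply: measurableI => //; exact: measurableC.
have key w : ~ divergence_set w -> (z < N w)%R <-> A w.
  move=> nD; have c := cvg_gxi nD; have lim0 := series_lim_ge0 (g0 ^~ w) c.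
  rewrite N_cvg// /A; have [z0|z0] := ltP z 0%R.
    by split=> // _; rewrite (lt_le_trans z0)// sqrtr_ge0.
  rewrite /= /S nneseries_EFin// lte_fin.
  rewrite -[limn _ in X in _ <-> (_ < X)%R]sqr_sqrtr//.
  by rewrite ltr_pXn2r ?nnegrE ?sqrtr_ge0.
apply/seteqP; split=> w /=.
  move=> zN; have [Dw|nD] := pselect (divergence_set w).
    by left; split=> //; rewrite /B -(N_dvg Dw) zN.
  by right; split=> //; apply/key.
move=> [[Dw]|[nD Aw]]; last by apply/(key w nD).
by rewrite /B N_dvg//; case: ifP.
Qed.

(* Chernoff bound with exponent [1 / (4 mu)]. *)
Lemma quantile_le (mu z x : R) : (0 < mu)%R -> (0 <= z)%R ->
  (forall k, g k ^+ 2 * lam k <= mu)%R ->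
  P [set w | (z < N w)%R] = (expR (- x))%:E ->
  (z ^+ 2 <= 2 * limn (series (fun k => g k ^+ 2 * lam k)) + 4 * x * mu)%R.
Proof.
move=> mu0 z0 gmu Pz; set V := limn _.
have cV : cvgn (series (fun k => g k ^+ 2 * lam k)%R).
  by apply: (cvg_series_mul_bounded (K := K) _ _ lam_cvg) => // k; rewrite sqr_ge0/=.
(* The largest exponent for which [g k ^+ 2 * lam k <= mu] yields [t k * lam k <= 1/4]. *)
pose r : R := (4 * mu)^-1%R.
have r0 : (0 < r)%R by rewrite invr_gt0 mulr_gt0.
pose t k := (r * g k ^+ 2)%R.
have t0 k : (0 <= t k)%R by rewrite mulr_ge0 ?sqr_ge0// ltW.
have tl k : (t k * lam k <= 4^-1)%R.
  rewrite /t -mulrA -ler_pdivlMl// invrK [leRHS](_ : _ = mu)//.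
  by rewrite mulrC mulrA mulVf// mul1r.
have tlE : (fun k => t k * lam k)%R = (r *: (fun k => g k ^+ 2 * lam k) : nat -> R)%R.
  by apply/funext => k; rewrite /t -mulrA.
have ctl : cvgn (series (fun k => t k * lam k)%R).
  by rewrite tlE; exact: is_cvg_seriesZ.
have mE := measurable_exp_series t0.
have E0 := exp_series_ge0 t0.
have := le_integral_abse P measurableT mE (expR_gt0 (r * z ^+ 2)).
under eq_integral do rewrite gee0_abs//.
move=> h; have {}h := le_trans h (integral_exp_series t0 tl ctl).
have mD := measurable_divergence_set.
have mT z' := measurable_noise_tail z'.
have : P [set w | (z < N w)%R] <=
    P (setT `&` [set w | (expR (r * z ^+ 2))%:E <= `|exp_series t w|]).
  have mF : measurable (setT `&` [set w | (expR (r * z ^+ 2))%:E <= `|exp_series t w|]).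
    by apply: emeasurable_fun_c_infty => //; exact: measurableT_comp.
  (* The inclusion of events holds only off the divergence set, which is added to the larger event
     at no cost. *)
  rewrite -(measureU0 mF mD divergence_set_null).
  apply: le_measure; rewrite ?inE.
  - exact: mT.
  - exact: measurableU.
  move=> w /= zN; have [Dw|nD] := pselect (divergence_set w); first by right.
  left; split=> //; rewrite gee0_abs//.
  have c := cvg_gxi nD.
  have tE : (fun k => t k * xi k w ^+ 2)%R = (r *: (fun k => g k ^+ 2 * xi k w ^+ 2) : nat -> R)%R.
    by apply/funext => k; rewrite /t -mulrA.
  rewrite exp_seriesE ?lee_fin ?ler_expR; last by rewrite tE; exact: is_cvg_seriesZ.
  rewrite tE lim_seriesZ// ler_pM2l//.
  have l0 := series_lim_ge0 (fun k => mulr_ge0 (sqr_ge0 (g k)) (sqr_ge0 (xi k w))) c.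
  move: zN; rewrite N_cvg// => zN; rewrite -[leRHS]sqr_sqrtr//.
  by rewrite ler_pXn2r ?nnegrE ?sqrtr_ge0// ltW.
rewrite Pz => h2.
have : (expR (r * z ^+ 2))%:E * (expR (- x))%:E <=
    (expR (2 * limn (series (fun k => t k * lam k)%R)))%:E.
  by apply: le_trans h; rewrite lee_pmul2l// lte_fin expR_gt0.
rewrite -EFinM -expRD lee_fin ler_expR tlE lim_seriesZ// -/V => h3.
have -> : (z ^+ 2 = (4 * mu) * (r * z ^+ 2))%R by rewrite /r; field; rewrite gt_eqF.
have -> : (2 * V + 4 * x * mu = (4 * mu) * (2 * (r * V) + x))%R.
  by rewrite /r; field; rewrite gt_eqF.
by rewrite ler_pM2l ?mulr_gt0// -lerBlDr.
Qed.

End quantile.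

End gaussian_series.

(** * Spectral calculus in coordinates *)

Section inner_product.
Context {R : realType} (X : completeNormedModType R) (ip : {dot X for idfun}).
Hypothesis ip_norm : forall x : X, `|x| ^+ 2 = ip x x.

Lemma ipC x y : ip x y = ip y x.
Proof. by have := hermC ip x y; rewrite expr0 mul1r. Qed.

Lemma ipDr x y z : ip x (y + z) = ip x y + ip x z.
Proof. exact: (raddfD (ip x)). Qed.

Lemma ipBr x y z : ip x (y - z) = ip x y - ip x z.
Proof. exact: (raddfB (ip x)). Qed.

Lemma ipZr c x y : ip x (c *: y) = c * ip x y.
Proof. exact: (linearZ_LR (ip x)). Qed.

Lemma ip0r x : ip x 0 = 0.
Proof. exact: (raddf0 (ip x)). Qed.

Lemma ip_sumr x (u : nat -> X) m n :
  ip x (\sum_(m <= k < n) u k) = \sum_(m <= k < n) ip x (u k).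
Proof. exact: (raddf_sum (ip x)). Qed.

Lemma ipDl x y z : ip (x + y) z = ip x z + ip y z.
Proof. by rewrite ipC ipDr !(ipC z). Qed.

Lemma ipZl c x y : ip (c *: x) y = c * ip x y.
Proof. by rewrite ipC ipZr (ipC y). Qed.

Lemma ipBl x y z : ip (x - y) z = ip x z - ip y z.
Proof. by rewrite ipC ipBr !(ipC z). Qed.

Lemma cauchy_schwarz x y : `|ip x y| <= `|x| * `|y|.
Proof.
have [->|y0] := eqVneq y 0; first by rewrite ip0r !normr0 mulr0.
have y2 : 0 < ip y y by rewrite -ip_norm exprn_gt0// normr_gt0.
rewrite -ler_sqr ?nnegrE ?mulr_ge0// exprMn !ip_norm real_normK ?num_real//.
pose c := ip x y / ip y y.
have : 0 <= ip (x - c *: y) (x - c *: y) by rewrite -ip_norm sqr_ge0.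
rewrite ipBr !ipBl !ipZr !ipZl (ipC y x).
rewrite -(pmulr_lge0 _ y2) (_ : _ * _ = ip x x * ip y y - ip x y ^+ 2) ?subr_ge0//.
by rewrite /c; field; rewrite gt_eqF.
Qed.

Lemma cvg_ip (u : nat -> X) (x y : X) :
  u @ \oo --> x -> (fun n => ip (u n) y) @ \oo --> ip x y.
Proof.
move=> ux; apply/cvgrPdist_le => eps eps0.
have y1 : 0 < `|y| + 1 by rewrite ltr_pwDr.
move/cvgrPdist_le: ux => /(_ _ (divr_gt0 eps0 y1)).
apply: filterS => n h; rewrite -ipBl.
apply: le_trans (cauchy_schwarz _ _) _; rewrite -(divfK (lt0r_neq0 y1) eps).
by apply: ler_pM => //; rewrite lerDl.
Qed.

Section basis.
Variable e : nat -> X.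
Hypothesis e_onb : orthonormal_basis ip setT e.

Lemma onb_ip j k : ip (e j) (e k) = (j == k)%:R.
Proof. by case: e_onb => h _; exact: h. Qed.

Lemma onb_partial_sum_ip (c : nat -> R) n j :
  ip (e j) (\sum_(0 <= k < n) c k *: e k) = if (j < n)%N then c j else 0.
Proof.
rewrite ip_sumr; under eq_bigr do rewrite ipZr onb_ip.
elim: n => [|n IHn]; first by rewrite big_geq.
rewrite big_nat_recr//= IHn ltnS; have [jn|nj|->] := ltngtP j n.
- by rewrite mulr0 addr0.
- by rewrite mulr0 addr0.
- by rewrite mulr1 add0r.
Qed.

Lemma onb_block_norm (c : nat -> R) m n :
  `|\sum_(m <= k < n) c k *: e k| ^+ 2 = \sum_(m <= k < n) c k ^+ 2.
Proof.
elim: n => [|n IHn]; first by rewrite !big_geq// normr0 expr0n.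
have [mn|nm] := leqP m n; last by rewrite !big_geq// normr0 expr0n.
rewrite !big_nat_recr//= -IHn !ip_norm ipDl !ipDr !ipZl !ipZr onb_ip eqxx.
rewrite (ipC _ (e n)) (_ : ip (e n) _ = 0).
  by rewrite !mulr0 addr0 add0r mulr1 expr2.
rewrite ip_sumr big_nat_cond big1// => k /andP[/andP[_ kn] _].
by rewrite ipZr onb_ip gtn_eqF// mulr0.
Qed.

Lemma riesz_fischer (c : nat -> R) : cvgn (series (fun k => c k ^+ 2)) ->
  cvgn (series (fun k => c k *: e k)).
Proof.
move=> cc; apply/cauchy_cvgP; apply/cauchy_seriesP => eps eps0.
have eps2 : 0 < eps ^+ 2 by rewrite exprn_gt0.
move/cauchy_cvgP/cauchy_seriesP: cc => /(_ _ eps2); apply: filterS => -[m n] /= h.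
rewrite -ltr_sqr ?nnegrE// ?ltW// onb_block_norm.
by apply: le_lt_trans h; exact: ler_norm.
Qed.

Lemma onb_coord (c : nat -> R) j : cvgn (series (fun k => c k *: e k)) ->
  ip (limn (series (fun k => c k *: e k))) (e j) = c j.
Proof.
move=> cc; rewrite -(cvg_lim (@Rhausdorff R) (cvg_ip (y := e j) cc)).
apply/cvg_lim => //; apply: cvg_near_cst; exists j.+1 => // n /= jn.
by rewrite ipC [series _ _]/= onb_partial_sum_ip jn.
Qed.

Lemma parseval_cvg x : series (fun k => ip x (e k) ^+ 2) @ \oo --> `|x| ^+ 2.
Proof.
case: e_onb => _ /(_ x) h.
have hs : series (fun k => ip x (e k) *: e k) @ \oo --> x.
  apply: cvg_trans h; apply: near_eq_cvg; apply: nearW => n; rewrite /series/=.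
  by apply: eq_bigl => k; rewrite mem_set.
rewrite (_ : series _ = (fun n => `|series (fun k => ip x (e k) *: e k) n| ^+ 2)).
  by apply: cvgM; apply: cvg_norm.
by apply/funext => n; rewrite onb_block_norm.
Qed.

Lemma parseval x : `|x| ^+ 2 = limn (series (fun k => ip x (e k) ^+ 2)).
Proof. by apply/esym/cvg_lim => //; exact: parseval_cvg. Qed.

Lemma parseval_is_cvg x : cvgn (series (fun k => ip x (e k) ^+ 2)).
Proof. by apply/cvg_ex; eexists; exact: parseval_cvg. Qed.

End basis.
End inner_product.

Section spectral.
Context {R : realType} (X Y : completeNormedModType R).
Context (ipX : {dot X for idfun}) (ipY : {dot Y for idfun}).
Hypothesis ipX_norm : forall x : X, `|x| ^+ 2 = ipX x x.
Hypothesis ipY_norm : forall y : Y, `|y| ^+ 2 = ipY y y.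
Variables (T : {linear X -> Y}) (Ts : Y -> X).
Hypothesis T_cont : continuous T.
Hypothesis T_adj : is_adjoint ipX ipY T Ts.
Variables (lam : nat -> R) (e : nat -> X).
Hypothesis h_eig : eigenbasis ipX (Ts \o T) lam e.

Let e_onb : orthonormal_basis ipX setT e.
Proof. by case: h_eig. Qed.

Lemma ip_image_eigenvector f k : ipY (T f) (T (e k)) = lam k * ipX f (e k).
Proof.
rewrite T_adj; case: h_eig => _ /(_ k) h _ _ _.
by rewrite -[Ts (T (e k))]/((Ts \o T) (e k)) h ipZr.
Qed.

(** Read as covariances of the noise process, these make the variables [Z (T (e k))] uncorrelated
    with variances [lam k]. *)
Lemma ip_image_eigenvectors j k :
  ipY (T (e j)) (T (e k)) = lam k * (j == k)%:R.
Proof. by rewrite ip_image_eigenvector (onb_ip e_onb). Qed.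

(** The filter axioms and the qualification speak of [[0, opnorm (Ts \o T)]] and become usable at
    the eigenvalues through this. As [opnorm] is a supremum of reals, boundedness comes first: with
    [y = Ts (T x)], the adjoint relation gives [|y|^2 = <T y, T x>], and [T] is Lipschitz. *)
Lemma eigenvalue_le_opnorm k : lam k \in `[0, opnorm (Ts \o T)].
Proof.
have [_ eig lam0 _ _] := h_eig.
rewrite in_itv/= ltW//=; have [K K0 TK] := linear_lipschitz T_cont.
have ek1 : `|e k| = 1.
  have := ipX_norm (e k); rewrite (onb_ip e_onb) eqxx => /eqP.
  by rewrite sqrp_eq1// => /eqP.
apply: ub_le_sup; last first.
  exists (e k); first by rewrite /= ek1.
  by rewrite eig normrZ ek1 mulr1 gtr0_norm.
exists (K * K) => _ [x /= x1 <-].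
have [->|z0] := eqVneq (Ts (T x)) 0; first by rewrite normr0 mulr_ge0// ltW.
have z1 : 0 < `|Ts (T x)| by rewrite normr_gt0.
rewrite -(ler_pM2r z1) -expr2 ipX_norm -T_adj (ipC ipY).
apply: le_trans (ler_norm _) _; apply: le_trans (cauchy_schwarz ipY_norm _ _) _.
rewrite -mulrA; apply: ler_pM => //.
by rewrite (le_trans (TK x))// -[leRHS]mulr1 ler_wpM2l// ltW.
Qed.

Lemma onb_series_cvg (c : nat -> R) :
  cvgn (series (fun k => c k *: e k)) -> cvgn (series (fun k => c k ^+ 2)).
Proof.
move=> cc; have := parseval_is_cvg ipX_norm e_onb
  (x := limn (series (fun k => c k *: e k))).
by under eq_fun do rewrite (onb_coord ipX_norm e_onb _ cc).
Qed.

Lemma adjoint_process_coord (W : Y -> R) k :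
  cvgn (series (fun k => W (T (e k)) ^+ 2)) ->
  ipX (adjoint_process e T W) (e k) = W (T (e k)).
Proof.
move=> cW; rewrite /adjoint_process; apply: (onb_coord ipX_norm e_onb).
exact: riesz_fischer.
Qed.

Lemma funcalc_coord (g : R -> R) (K : R) x k :
  (forall k, `|g (lam k)| <= K) ->
  ipX (funcalc ipX lam e g x) (e k) = g (lam k) * ipX x (e k).
Proof.
move=> gK; rewrite /funcalc.
apply: (onb_coord ipX_norm e_onb (c := fun k => g (lam k) * ipX x (e k))).
apply: (riesz_fischer ipX_norm e_onb).
rewrite (_ : (fun _ => _) = (fun k => g (lam k) ^+ 2 * ipX x (e k) ^+ 2)).
  apply: (cvg_series_mul_bounded (K := K ^+ 2) _ _ (parseval_is_cvg ipX_norm e_onb (x := x))) => j.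
    exact: sqr_ge0.
  by rewrite sqr_ge0/= -[leLHS]real_normK ?num_real// ler_pXn2r ?nnegrE// (le_trans _ (gK j)).
by apply/funext => j; rewrite exprMn.
Qed.

Lemma estimator_coord (g : R -> R) (K : R) (W : Y -> R) k :
  (forall k, `|g (lam k)| <= K) ->
  cvgn (series (fun k => W (T (e k)) ^+ 2)) ->
  ipX (estimator ipX lam e T g W) (e k) = g (lam k) * W (T (e k)).
Proof.
by move=> gK cW; rewrite /estimator (funcalc_coord _ _ gK) adjoint_process_coord.
Qed.

Lemma estimator_sub_norm (g1 g2 : R -> R) (K : R) (W : Y -> R) :
  (forall k, `|g1 (lam k)| <= K) -> (forall k, `|g2 (lam k)| <= K) ->
  cvgn (series (fun k => W (T (e k)) ^+ 2)) ->
  `|estimator ipX lam e T g1 W - estimator ipX lam e T g2 W| ^+ 2 =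
  limn (series (fun k => (g1 (lam k) - g2 (lam k)) ^+ 2 * W (T (e k)) ^+ 2)).
Proof.
move=> g1K g2K cW; rewrite (parseval ipX_norm e_onb); congr (limn (series _)).
apply/funext => k; rewrite ipBl (estimator_coord _ g1K)// (estimator_coord _ g2K)//.
by rewrite -mulrBl exprMn.
Qed.

(* Where the series for [T^* W] diverges, [limn] is the default point, so the estimators no longer depend on [W]. *)
Lemma estimator_dvg (g1 g2 : R -> R) (W : Y -> R) :
  ~ cvgn (series (fun k => W (T (e k)) ^+ 2)) ->
  `|estimator ipX lam e T g1 W - estimator ipX lam e T g2 W| =
  `|funcalc ipX lam e g1 point - funcalc ipX lam e g2 point|.
Proof.
move=> nW; rewrite /estimator (_ : adjoint_process _ _ _ = point)//.
by apply: dvgP => cW; apply: nW; exact: onb_series_cvg.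
Qed.

End spectral.

(** * Bias and noise of the estimators *)

Section risk_decomposition.
Context {R : realType} (X Y : completeNormedModType R).
Context (ipX : {dot X for idfun}) (ipY : {dot Y for idfun}).
Hypothesis ipX_norm : forall x : X, `|x| ^+ 2 = ipX x x.
Variables (T : {linear X -> Y}) (Ts : Y -> X).
Hypothesis T_adj : is_adjoint ipX ipY T Ts.
Variables (lam : nat -> R) (e : nat -> X).
Hypothesis h_eig : eigenbasis ipX (Ts \o T) lam e.

Let e_onb : orthonormal_basis ipX setT e.
Proof. by case: h_eig. Qed.

Let lam_gt0 k : 0 < lam k.
Proof. by case: h_eig => _ _ + _ _; apply. Qed.

Let lam_le k : `|lam k| <= lam 0%N.
Proof. by rewrite gtr0_norm//; case: h_eig => _ _ _ + _; apply. Qed.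

(** Through Parseval, norm bounds for operators diagonal in [e] become scalar inequalities at each
    eigenvalue; [c = 0] shows that coordinates determine a vector. *)
Lemma norm_le_coord (c : R) x y : 0 <= c ->
  (forall k, `|ipX x (e k)| <= c * `|ipX y (e k)|) -> `|x| <= c * `|y|.
Proof.
move=> c0 h; rewrite -ler_sqr ?nnegrE ?mulr_ge0// exprMn.
rewrite !(parseval ipX_norm e_onb).
rewrite -[leRHS](lim_seriesZ (c ^+ 2) (parseval_is_cvg ipX_norm e_onb (x := y))).
apply: series_lim_le_series; last 2 first.
- exact: parseval_is_cvg.
- exact/is_cvg_seriesZ/parseval_is_cvg.
move=> k; rewrite -[leLHS]real_normK ?num_real//.
rewrite [leRHS](_ : _ = (c * `|ipX y (e k)|) ^+ 2).
  by rewrite ler_pXn2r ?nnegrE ?mulr_ge0.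
by rewrite exprMn real_normK ?num_real.
Qed.

Lemma coord_inj x y : (forall k, ipX x (e k) = ipX y (e k)) -> x = y.
Proof.
move=> h; apply/eqP; rewrite -subr_eq0 -normr_le0.
apply: le_trans (norm_le_coord (c := 0) (y := 0) _ _) _ => //.
by move=> k; rewrite ipBl h subrr normr0 mul0r.
Qed.

Section filter.
Variable g : R -> R.
Hypothesis g_ge0 : forall k, 0 <= g (lam k).
Hypothesis g_le1 : forall k, lam k * g (lam k) <= 1.
Variable K : R.
Hypothesis g_leK : forall k, `|g (lam k)| <= K.

(** The noiseless estimator [q_alpha(T^*T) T^*T f]; its distance to [f] is the bias. *)
Definition mean_estimator (f : X) : X := funcalc ipX lam e (fun x => x * g x) f.

Lemma mean_estimator_coord f k :
  ipX (mean_estimator f) (e k) = lam k * g (lam k) * ipX f (e k).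
Proof.
apply: (funcalc_coord ipX_norm h_eig (g := fun x => x * g x) (K := 1)) => j.
by rewrite ger0_norm// mulr_ge0// ltW.
Qed.

Lemma observation_cvg (W : Y -> R) (f : X) (s : R) :
  cvgn (series (fun k => W (T (e k)) ^+ 2)) ->
  cvgn (series (fun k => (ipY (T f) (T (e k)) + s * W (T (e k))) ^+ 2)).
Proof.
(* The data are the coordinates of the vector [T^*T f + s T^*W], so Parseval makes them square
   summable. *)
move=> cW; pose v := funcalc ipX lam e id f + s *: adjoint_process e T W.
have := parseval_is_cvg ipX_norm e_onb (x := v).
rewrite (_ : (fun k => ipX v (e k) ^+ 2) =
    (fun k => (ipY (T f) (T (e k)) + s * W (T (e k))) ^+ 2))//.
apply/funext => k; rewrite /v ipDl ipZl (funcalc_coord ipX_norm h_eig _ _ lam_le).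
by rewrite (adjoint_process_coord ipX_norm h_eig)// (ip_image_eigenvector T_adj h_eig).
Qed.

(** [funcalc] and [adjoint_process] are limits of series, additive only where these converge. The
    decomposition is therefore checked on coordinates, for paths with square summable
    [W (T (e k))]. *)
Lemma estimator_split (W : Y -> R) (f : X) (s : R) :
  cvgn (series (fun k => W (T (e k)) ^+ 2)) ->
  estimator ipX lam e T g (fun y => ipY (T f) y + s * W y) =
  mean_estimator f + s *: estimator ipX lam e T g W.
Proof.
move=> cW; apply: coord_inj => k.
rewrite ipDl ipZl mean_estimator_coord.
rewrite (estimator_coord ipX_norm h_eig _ g_leK cW).
rewrite (estimator_coord ipX_norm h_eig _ g_leK (observation_cvg (f := f) (s := s) cW)).
by rewrite (ip_image_eigenvector T_adj h_eig); ring.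
Qed.

Lemma source_bias_le (phi : R -> R) (Kphi b rho : R) (x : X) :
  (forall k, 0 <= phi (lam k) <= Kphi) -> 0 <= b ->
  (forall k, phi (lam k) * (1 - lam k * g (lam k)) <= b) -> `|x| <= rho ->
  `|mean_estimator (funcalc ipX lam e phi x) - funcalc ipX lam e phi x| <= b * rho.
Proof.
move=> phi0 b0 hb xr; apply: (@le_trans _ _ (b * `|x|)); last by rewrite ler_wpM2l.
apply: norm_le_coord => // k.
have phiK j : `|phi (lam j)| <= Kphi by have /andP[h1 h2] := phi0 j; rewrite ger0_norm.
rewrite ipBl mean_estimator_coord (funcalc_coord ipX_norm h_eig _ _ phiK).
rewrite (_ : _ - _ = - (phi (lam k) * (1 - lam k * g (lam k))) * ipX x (e k)); last by ring.
have /andP[p0 _] := phi0 k.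
have n0 : 0 <= phi (lam k) * (1 - lam k * g (lam k)) by rewrite mulr_ge0// subr_ge0.
by rewrite normrM normrN (ger0_norm n0) ler_wpM2r.
Qed.

End filter.

Section monotonicity.
Variables g1 g2 : R -> R.
Hypothesis g1_ge0 : forall k, 0 <= g1 (lam k).
Hypothesis g12 : forall k, g1 (lam k) <= g2 (lam k).
Hypothesis g2_le1 : forall k, lam k * g2 (lam k) <= 1.

Let g2_ge0 k : 0 <= g2 (lam k).
Proof. exact: le_trans (g12 k). Qed.

Let g1_le1 k : lam k * g1 (lam k) <= 1.
Proof. by apply: le_trans (g2_le1 k); rewrite ler_pM2l. Qed.

(** The ordering of the filter gives [0 <= 1 - lam g2 <= 1 - lam g1] on each coordinate, so a bias
    bound at one index persists at all later ones. *)
Lemma bias_monotone f : `|mean_estimator g2 f - f| <= `|mean_estimator g1 f - f|.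
Proof.
rewrite -[leRHS]mul1r; apply: norm_le_coord => // k; rewrite mul1r !ipBl.
have E c : c * ipX f (e k) - ipX f (e k) = (c - 1) * ipX f (e k).
  by rewrite mulrBl mul1r.
rewrite !mean_estimator_coord// !E !normrM ler_wpM2r//.
rewrite !ler0_norm ?subr_le0// lerN2 lerB//.
by rewrite ler_pM2l.
Qed.

(** On each coordinate [0 <= lam (g2 - g1) <= 1 - lam g1], which avoids the factor [2] of the
    triangle inequality. *)
Lemma mean_estimator_sub f :
  `|mean_estimator g1 f - mean_estimator g2 f| <= `|mean_estimator g1 f - f|.
Proof.
rewrite -[leRHS]mul1r; apply: norm_le_coord => // k; rewrite mul1r !ipBl.
have E c : c * ipX f (e k) - ipX f (e k) = (c - 1) * ipX f (e k).
  by rewrite mulrBl mul1r.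
rewrite !mean_estimator_coord// E -mulrBl !normrM ler_wpM2r//.
rewrite !ler0_norm ?subr_le0// ?ler_pM2l// lerN2 lerB//.
Qed.

End monotonicity.
End risk_decomposition.

(** * Rates and spectral sums *)

Section log_estimates.
Context {R : realType}.
Implicit Types x y t : R.

Lemma powR_exp x y : 0 < x -> x `^ y = expR (y * ln x).
Proof. by move=> x0; rewrite /powR gt_eqF. Qed.

Lemma ln_le_subr1 x : 0 < x -> ln x <= x - 1.
Proof.
by move=> x0; have := expR_ge1Dx (ln x); rewrite lnK ?posrE// lerBrDl.
Qed.

(** For [kap > 0] this is [ln x <= x - 1] at [x = (eps / kap) l]. With [l = - ln x] it absorbs
    powers of a logarithm into a small power of [x]. *)
Lemma ln_le_linear (eps kap : R) : 0 < eps ->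
  exists C, forall l, 1 <= l -> kap * ln l <= eps * l + C.
Proof.
move=> eps0; have [k0|k0] := lerP kap 0.
  exists 0 => l l1; rewrite addr0; apply: (@le_trans _ _ 0).
    by rewrite mulr_le0_ge0// ln_ge0.
  by rewrite mulr_ge0 ?(le_trans _ l1)// ltW.
have d0 : 0 < eps / kap by rewrite divr_gt0.
have dE : eps = kap * (eps / kap) by field; rewrite gt_eqF.
move: (eps / kap) d0 dE => del d0 ->; exists (- kap * ln del) => l l1.
have l0 : 0 < l by rewrite (lt_le_trans _ l1).
have := ln_le_subr1 (mulr_gt0 d0 l0); rewrite lnM ?posrE// => h.
have : kap * (ln del + ln l) <= kap * (del * l - 1) by rewrite ler_pM2l.
lra.
Qed.

Lemma oppr_ln_ge1 x : 0 < x -> x <= expR (- 1) -> 1 <= - ln x.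
Proof. by move=> x0; rewrite -ler_ln ?posrE ?expR_gt0// expRK lerNr. Qed.

Lemma powR_ln_bounded (eps kap : R) : 0 < eps ->
  exists2 K, 0 < K & forall x, 0 < x -> x <= expR (- 1) ->
    x `^ eps * (- ln x) `^ kap <= K.
Proof.
move=> /(ln_le_linear kap)[C hC]; exists (expR C); first exact: expR_gt0.
move=> x x0 xe; have l1 := oppr_ln_ge1 x0 xe; have l0 := lt_le_trans ltr01 l1.
rewrite !powR_exp// -expRD ler_expR; have := hC _ l1; lra.
Qed.

Section phi.
Variables (nu tau : R).
Hypothesis h_nutau : 0 < nu \/ (nu = 0 /\ 0 < tau).

Lemma phi_index_gt0 x : 0 < x -> x <= expR (- 1) -> 0 < phi_index nu tau x.
Proof.
move=> x0 xe; have l0 := lt_le_trans ltr01 (oppr_ln_ge1 x0 xe).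
by rewrite /phi_index gt_eqF// mulr_gt0// powR_gt0.
Qed.

Lemma phi_index_bounded : exists2 K, 0 < K &
  forall x, 0 < x -> x <= expR (- 1) -> phi_index nu tau x <= K.
Proof.
case: h_nutau => [nu0|[-> tau0]].
  have [K K0 hK] := powR_ln_bounded (- tau) nu0; exists K => // x x0 xe.
  by rewrite /phi_index gt_eqF//; exact: hK.
exists 1 => // x x0 xe; rewrite /phi_index gt_eqF// powRr0 mul1r.
have l1 := oppr_ln_ge1 x0 xe; have l0 := lt_le_trans ltr01 l1.
by rewrite powR_exp// -[leRHS]expR0 ler_expR mulNr oppr_le0 mulr_ge0 ?ln_ge0// ltW.
Qed.

(** At [m_max] the variance is at least [1], so the bias condition there only asks that [phi] be
    below a constant. *)
Lemma phi_index_small (eta : R) : 0 < eta -> exists2 del, 0 < del &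
  forall x, 0 < x -> x <= expR (- 1) -> x <= del -> phi_index nu tau x <= eta.
Proof.
move=> eta0; case: h_nutau => [nu0|[-> tau0]].
  have nu20 : 0 < nu / 2 by rewrite divr_gt0.
  have [C hC] := ln_le_linear (- tau) nu20.
  exists (expR ((ln eta - C) / (nu / 2))); first exact: expR_gt0.
  move=> x x0 xe xd; have l1 := oppr_ln_ge1 x0 xe; have l0 := lt_le_trans ltr01 l1.
  move: xd; rewrite -ler_ln ?posrE ?expR_gt0// expRK ler_pdivlMr// => xd.
  rewrite /phi_index gt_eqF// !powR_exp// -expRD -[leRHS]lnK ?posrE// ler_expR.
  have := hC _ l1; lra.
(* For [nu = 0] only the logarithm is small: [(- ln x)^(- tau) <= eta] means
   [- ln x >= eta^(- 1/tau)]. *)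
exists (expR (- expR (- ln eta / tau))); first exact: expR_gt0.
move=> x x0 xe xd; have l1 := oppr_ln_ge1 x0 xe; have l0 := lt_le_trans ltr01 l1.
move: xd; rewrite -ler_ln ?posrE ?expR_gt0// expRK => xd.
rewrite /phi_index gt_eqF// powRr0 mul1r powR_exp// -[leRHS]lnK ?posrE// ler_expR.
have : expR (- ln eta / tau) <= - ln x by rewrite lerNr.
rewrite -ler_ln ?posrE ?expR_gt0// expRK ler_pdivrMr//; lra.
Qed.

End phi.

(* With [L = - ln alpha] and [l = - ln t], the hypothesis reads [p L <= l - 2 tau ln L + O(1)] and the conclusion [p L <= l - 2 tau ln l + O(1)], so the point is to compare [ln L] and [ln l]. *)
Lemma rate_bound (nu tau r c : R) : 0 <= nu -> 0 < r -> 0 < c ->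
  exists2 C, 0 < C & forall t al, 0 < t -> t <= expR (- 1) ->
    0 < al -> al <= expR (- 1) ->
    c * t * al `^ (- r) <= phi_index nu tau al ^+ 2 ->
    t * al `^ (- r) <= C * t `^ (2 * nu / (2 * nu + r))
                         * (- ln t) `^ (- (2 * tau * r / (2 * nu + r))).
Proof.
move=> nu0 r0 c0; set p := 2 * nu + r.
have p0 : 0 < p by rewrite ltr_wpDl// mulr_ge0.
suff [C hC] : exists C, forall l L, 1 <= l -> 1 <= L ->
    p * L <= l - 2 * tau * ln L - ln c -> p * L <= l - 2 * tau * ln l + C.
  exists (expR (C * (r / p))); first exact: expR_gt0.
  move=> t al t0 te al0 ale.
  have l1 := oppr_ln_ge1 t0 te; have L1 := oppr_ln_ge1 al0 ale.
  have l0 := lt_le_trans ltr01 l1; have L0 := lt_le_trans ltr01 L1.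
  rewrite /phi_index gt_eqF// !powR_exp//.
  have cE : c = expR (ln c) by rewrite lnK.
  have tE : t = expR (ln t) by rewrite lnK.
  rewrite -expRD -expRM_natl {1}cE {1}tE -!expRD.
  rewrite [X in _ -> X * _ <= _]tE -!expRD !ler_expR => h.
  have /(hC _ _ l1 L1) : p * (- ln al) <= - ln t - 2 * tau * ln (- ln al) - ln c.
    by move: h; rewrite /p; lra.
  move=> h2; have := ler_wpM2l (ltW (divr_gt0 r0 p0)) h2.
  have -> : r / p * (p * - ln al) = r * - ln al by field; rewrite gt_eqF.
  have -> : r / p * (- ln t - 2 * tau * ln (- ln t) + C) =
     - ln t + 2 * nu / p * ln t - 2 * tau * r / p * ln (- ln t) + C * (r / p).
    by rewrite /p; field; rewrite -/p gt_eqF.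
  lra.
(* For [tau >= 0] one needs [ln l <= ln L + O(1)]. Either [l < 2 p L], which gives it, or
   [p L <= l / 2], and the other half of [l] absorbs the logarithm. *)
clearbody p; have [tau0|tau0] := lerP 0 tau.
  have h2 : 0 < 2^-1 :> R by rewrite invr_gt0.
  have [C1 hC1] := ln_le_linear (2 * tau) h2.
  pose C2 := 2 * tau * ln (2 * p) - ln c.
  exists (Num.max C1 C2) => l L l1 L1 h.
  have l0 := lt_le_trans ltr01 l1; have L0 := lt_le_trans ltr01 L1.
  have [m1 m2] : C1 <= Num.max C1 C2 /\ C2 <= Num.max C1 C2.
    by rewrite !le_max !lexx orbT.
  have [Ll|lL] := lerP (2 * p * L) l; first by have := hC1 _ l1; lra.
  have : ln l <= ln (2 * p) + ln L.
    by rewrite -lnM ?posrE ?mulr_gt0// ler_ln ?posrE ?mulr_gt0// ltW.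
  move=> /(ler_wpM2l (mulr_ge0 (ler0n _ 2) tau0)); move: m2; rewrite /C2; lra.
(* For [tau < 0] one needs [ln L <= ln l + O(1)]; the hypothesis itself gives [L <= B l] once its
   logarithm is absorbed into [p L / 2]. *)
have p20 : 0 < p / 2 by rewrite divr_gt0.
have [C1 hC1] := ln_le_linear (- (2 * tau)) p20.
pose B := (1 + `|C1 - ln c|) / (p / 2).
have B0 : 0 < B by rewrite divr_gt0// ltr_pwDl.
exists (- (2 * tau) * ln B - ln c) => l L l1 L1 h.
have l0 := lt_le_trans ltr01 l1; have L0 := lt_le_trans ltr01 L1.
have LB : L <= B * l.
  rewrite /B mulrAC ler_pdivlMr// mulrDl mul1r.
  have := ler_norm (C1 - ln c); have := ler_peMr (normr_ge0 (C1 - ln c)) l1.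
  by have := hC1 _ L1; lra.
clearbody B; have : ln L <= ln B + ln l by rewrite -lnM ?posrE// ler_ln ?posrE ?mulr_gt0//.
have tau2 : 0 <= - (2 * tau) by lra.
by move=> /(ler_wpM2l tau2); lra.
Qed.

End log_estimates.

Section spectral_sums.
Context {R : realType}.

(** One step of the integral test: the right side is the integral of [y^(- (1 + b))] over
    [[x, x + 1]], bounded below here through [ln x <= x - 1] and [1 + x <= exp x]. *)
Lemma tail_step (b x : R) : 0 < b -> 0 < x ->
  (x + 1) `^ (- (1 + b)) <= (x `^ (- b) - (x + 1) `^ (- b)) / b.
Proof.
move=> b0 x0; have x10 : 0 < x + 1 by rewrite addr_gt0.
rewrite ler_pdivlMr//; set y := (x + 1) `^ (- b).
have y0 : 0 < y by rewrite powR_gt0.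
have -> : (x + 1) `^ (- (1 + b)) = y * (x + 1)^-1.
  rewrite (_ : - (1 + b) = - b + -1); last by ring.
  by rewrite powRD ?(gt_eqF x10) ?implybT// powR_inv1// ltW.
have xE : x `^ (- b) = y * (expR (- b * ln (x / (x + 1)))).
  by rewrite /y !powR_exp// -expRD lnM ?posrE ?invr_gt0// lnV ?posrE//; congr expR; ring.
have h1 := ln_le_subr1 (divr_gt0 x0 x10).
have h2 := expR_ge1Dx (- b * ln (x / (x + 1))).
have h3 : b * (x + 1)^-1 <= expR (- b * ln (x / (x + 1))) - 1.
  have : b * ln (x / (x + 1)) <= b * (x / (x + 1) - 1) by rewrite ler_pM2l.
  have -> : b * (x / (x + 1) - 1) = - (b * (x + 1)^-1) by field; rewrite gt_eqF.
  lra.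
by rewrite xE; have := ler_wpM2l (ltW y0) h3; lra.
Qed.

Lemma tail_sum (b : R) (K n : nat) : 0 < b -> (0 < K)%N ->
  \sum_(K <= k < K + n) k.+1%:R `^ (- (1 + b)) <= K%:R `^ (- b) / b.
Proof.
move=> b0 K0.
suff : \sum_(K <= k < K + n) k.+1%:R `^ (- (1 + b)) <=
    (K%:R `^ (- b) - (K + n)%:R `^ (- b)) / b.
  move/le_trans; apply; rewrite ler_pM2r ?invr_gt0// gerBl.
  exact: powR_ge0.
elim: n => [|n IHn]; first by rewrite addn0 big_geq// subrr mul0r.
rewrite addnS big_nat_recr ?leq_addr//=.
have Kn : 0 < (K + n)%:R :> R by rewrite ltr0n addn_gt0 K0.
have := tail_step b0 Kn; rewrite natr1 => h; apply: le_trans (lerD IHn h) _.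
by rewrite -mulrDl addrA subrK.
Qed.

Variables (lam : nat -> R) (cmin cmax a : R).
Hypotheses (cmin0 : 0 < cmin) (cmax0 : 0 < cmax) (a1 : 1 < a).
Hypothesis lam_decay : forall k : nat,
  cmin * k.+1%:R `^ (- a) <= lam k <= cmax * k.+1%:R `^ (- a).

(* The first [alpha^(-1/a)] terms are bounded by [1 / lam k], the others by [lam k (Cq / alpha)^2]. *)
Lemma variance_sum_le (Cq : R) : 0 < Cq -> exists2 C, 0 < C &
  forall (al : R) (u : nat -> R), 0 < al -> al <= 1 ->
    (forall k, 0 <= u k) -> (forall k, lam k * u k <= 1) ->
    (forall k, al * u k <= Cq) ->
    forall n, \sum_(0 <= k < n) lam k * u k ^+ 2 <= C * al `^ (- (1 + a^-1)).
Proof.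
move=> Cq0; pose b := a - 1; have b0 : 0 < b by rewrite subr_gt0.
have a0 : 0 < a by rewrite (lt_trans ltr01).
have aE : a = 1 + b by rewrite /b; ring.
exists (2 `^ (1 + a) / cmin + cmax * Cq ^+ 2 / b).
  by rewrite addr_gt0// divr_gt0// ?powR_gt0// mulr_gt0// exprn_gt0.
move=> al u al0 al1 u0 lu1 alu n.
have lam0 k : 0 < lam k.
  by have /andP[+ _] := lam_decay k; apply: lt_le_trans; rewrite mulr_gt0// powR_gt0.
pose A := al `^ (- a^-1).
have A1 : 1 <= A.
  rewrite /A powR_exp// -[leLHS]expR0 ler_expR mulNr oppr_ge0 mulr_ge0_le0//.
    by rewrite invr_ge0 ltW.
  by apply: ln_le0.
have A0 : 0 < A by rewrite (lt_le_trans ltr01).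
(* An integer in [[A, 2 A]], thanks to [A >= 1]; the upper end produces the factor [2^(1 + a)]. *)
pose K := (Num.truncn A).+1.
have [AK KA] : A <= K%:R /\ K%:R <= 2 * A.
  have /andP[h1 h2] := truncn_itv (ltW A0); split; first exact: ltW.
  by rewrite /K -natr1; lra.
have K0 : 0 < K%:R :> R by rewrite ltr0n.
have sq0 k : 0 <= lam k * u k ^+ 2 by rewrite mulr_ge0 ?sqr_ge0// ltW.
apply: (@le_trans _ _ (\sum_(0 <= k < K + n) lam k * u k ^+ 2)).
  by rewrite [leRHS](@big_cat_nat _ _ _ n) ?leq_addl//= lerDl sumr_ge0.
rewrite (@big_cat_nat _ _ _ K) ?leq_addr//= mulrDl.
have lnA : ln A = - a^-1 * ln al by rewrite /A powR_exp// expRK.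
apply: lerD.
  apply: (@le_trans _ _ (\sum_(0 <= k < K) K%:R `^ a / cmin)).
    rewrite big_nat_cond [leRHS]big_nat_cond; apply: ler_sum => k /andP[/andP[_ kK] _].
    have q0 : 0 < (K%:R : R) `^ (- a) by rewrite powR_gt0.
    have qk : K%:R `^ (- a) <= k.+1%:R `^ (- a) :> R.
      rewrite !powRN lef_pV2 ?posrE ?powR_gt0//.
      by rewrite ge0_ler_powR ?nnegrE ?ler_nat// ltW.
    rewrite ler_pdivlMr// -[a in leRHS]opprK powRN -[leRHS]mul1r ler_pdivlMr//.
    apply: (@le_trans _ _ (lam k * u k ^+ 2 * lam k)).
      rewrite -mulrA ler_wpM2l//; case/andP: (lam_decay k) => + _.
      by apply: le_trans; rewrite ler_pM2l.
    rewrite (_ : _ * _ * _ = (lam k * u k) ^+ 2); last by ring.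
    by rewrite expr_le1// mulr_ge0// ltW.
  rewrite sumr_const_nat subn0 -[leLHS]mulr_natl [leLHS]mulrA [leRHS]mulrAC ler_pM2r ?invr_gt0//.
  rewrite -{1}[K%:R]powRr1// -powRD ?(gt_eqF K0) ?implybT//.
  apply: (@le_trans _ _ ((2 * A) `^ (1 + a))).
    by rewrite ge0_ler_powR ?nnegrE ?addr_ge0 ?mulr_ge0// ltW.
  rewrite powRM ?(ltW A0)// ler_pM2l ?powR_gt0//.
  rewrite !powR_exp// lnA ler_expR le_eqVlt; apply/orP; left; apply/eqP.
  by field; rewrite gt_eqF.
apply: (@le_trans _ _ (cmax * (Cq / al) ^+ 2 * \sum_(K <= k < K + n) k.+1%:R `^ (- (1 + b)))).
  rewrite mulr_sumr; apply: ler_sum => k _; rewrite -aE.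
  have uk : u k ^+ 2 <= (Cq / al) ^+ 2.
    have uC : u k <= Cq / al by rewrite ler_pdivlMr// mulrC.
    by rewrite ler_pXn2r ?nnegrE// (le_trans _ uC).
  case/andP: (lam_decay k) => _ lk; rewrite mulrAC.
  by apply: ler_pM; rewrite ?sqr_ge0// ltW.
apply: (@le_trans _ _ (cmax * (Cq / al) ^+ 2 * (A `^ (- b) / b))).
  rewrite ler_wpM2l//; first exact: mulr_ge0 (ltW cmax0) (sqr_ge0 _).
  apply: le_trans (tail_sum n b0 (ltn0Sn _)) _.
  rewrite ler_pM2r ?invr_gt0// !powRN lef_pV2 ?posrE ?powR_gt0//.
  by rewrite ge0_ler_powR ?nnegrE// ltW.
rewrite exprMn exprVn.
have -> : cmax * (Cq ^+ 2 * (al ^+ 2)^-1) * (A `^ (- b) / b) =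
    cmax * Cq ^+ 2 / b * ((al ^+ 2)^-1 * A `^ (- b)).
  by field; rewrite !gt_eqF.
rewrite ler_pM2l; last by rewrite divr_gt0// mulr_gt0// exprn_gt0.
rewrite -powR_mulrn ?(ltW al0)// -powRN !powR_exp// lnA -expRD ler_expR.
rewrite le_eqVlt; apply/orP; left; apply/eqP; rewrite /b.
by field; rewrite gt_eqF.
Qed.

End spectral_sums.

Section sweep_estimates.
Context {R : realType}.

(** The power of [t] left over beside the rate is [r / (2 nu + r) > 0], which beats every power of
    the logarithm. This makes the cost [sigma^2 m_max^2] of late stops negligible. *)
Lemma log_sqr_le_rate (nu tau r : R) : 0 <= nu -> 0 < r ->
  exists2 K, 0 < K & forall t, 0 < t -> t <= expR (- 1) ->
    t * (- ln t) ^+ 2 <= K * t `^ (2 * nu / (2 * nu + r))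
                           * (- ln t) `^ (- (2 * tau * r / (2 * nu + r))).
Proof.
move=> nu0 r0; set p := 2 * nu + r.
have p0 : 0 < p by rewrite ltr_wpDl// mulr_ge0.
have [C hC] := ln_le_linear (2 + 2 * tau * r / p) (divr_gt0 r0 p0).
exists (expR C); first exact: expR_gt0.
move=> t t0 te; have l1 := oppr_ln_ge1 t0 te; have l0 := lt_le_trans ltr01 l1.
rewrite -powR_mulrn ?(ltW l0)// !powR_exp// -{1}[t]lnK ?posrE// -!expRD ler_expR.
have := hC _ l1.
have -> : r / p * - ln t = - ln t + 2 * nu / p * ln t.
  by rewrite /p; field; rewrite -/p gt_eqF.
lra.
Qed.

(** The lower bound on [V] gives [1 / al <= (V / c)^(1/r)]. Since [r > 1], the remaining power
    [V^(1 - 1/r)] has room for the logarithm. *)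
Lemma log_level_bound (r c V0 : R) : 1 < r -> 0 < c -> 0 < V0 ->
  exists2 C, 0 < C & forall al V, 0 < al -> V0 <= V -> c * al `^ (- r) <= V ->
    ln (V / V0) / al <= C * V.
Proof.
move=> r1 c0 V00; have r0 : 0 < r by rewrite (lt_trans ltr01).
pose del := 1 - r^-1; have del0 : 0 < del by rewrite subr_gt0 invf_lt1.
exists (del^-1 * expR (- del * ln V0 - ln c / r)).
  by rewrite mulr_gt0 ?invr_gt0// expR_gt0.
move=> al V al0 VV cV; have V_0 : 0 < V by rewrite (lt_le_trans V00).
have y1 : del * ln (V / V0) <= expR (del * ln (V / V0)).
  by have := expR_ge1Dx (del * ln (V / V0)); lra.
have a1 : al^-1 <= expR ((ln V - ln c) / r).
  rewrite -[leLHS]lnK ?posrE ?invr_gt0// lnV ?posrE// ler_expR ler_pdivlMr//.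
  move: cV; rewrite -ler_ln ?posrE ?mulr_gt0 ?powR_gt0// lnM ?posrE ?powR_gt0//.
  by rewrite powR_exp// expRK; lra.
rewrite -(ler_pM2l del0); apply: (@le_trans _ _
    (expR (del * ln (V / V0)) * expR ((ln V - ln c) / r))).
  rewrite mulrA; apply: ler_pM => //; last by rewrite invr_ge0 ltW.
  rewrite mulr_ge0 ?(ltW del0)// ln_ge0//.
  by rewrite ler_pdivlMr// mul1r.
rewrite mulrA mulrA divff ?mul1r ?gt_eqF//.
rewrite -[V in leRHS]lnK ?posrE// -!expRD ler_expR ln_div ?posrE//.
rewrite le_eqVlt; apply/orP; left; apply/eqP; rewrite /del.
by field; rewrite gt_eqF.
Qed.

(** Meant for [n = m_max - 1], whence [n + 2 = m_max + 1]. The variance at [n] is still below [1],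
    except possibly at [n = 0], because [m_max] is positive by definition. *)
Lemma geometric_index_bound (theta V0 : R) : 1 < theta -> 0 < V0 ->
  exists2 C, 0 < C & forall t (n : nat), 0 < t -> t <= expR (- 1) ->
    n = 0%N \/ t * (theta ^+ n * V0) < 1 -> n%:R + 2 <= C * - ln t.
Proof.
move=> th1 V00; have th0 : 0 < theta by rewrite (lt_trans ltr01).
have lth : 0 < ln theta by rewrite ln_gt0.
exists (2 + (1 + `|ln V0|) / ln theta).
  by rewrite addr_gt0// divr_gt0// ltr_pwDl.
move=> t n t0 te h; have l1 := oppr_ln_ge1 t0 te; have l0 := lt_le_trans ltr01 l1.
rewrite mulrDl addrC; apply: lerD; first by rewrite ler_peMr.
case: h => [->|]; first by rewrite mulr_ge0 ?(ltW l0)// divr_ge0 ?(ltW lth)// addr_ge0.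
rewrite -ltr_ln ?posrE ?mulr_gt0 ?exprn_gt0// ln1 !lnM ?posrE ?mulr_gt0 ?exprn_gt0//.
rewrite lnXn// => h; rewrite mulrAC ler_pdivlMr// mulrDl mul1r.
have := ler_peMr (normr_ge0 (ln V0)) l1; have := ler_norm (- ln V0); rewrite normrN.
move: h; rewrite -mulr_natl; lra.
Qed.

End sweep_estimates.

(** * The SOLIT rule *)

Section integral_off_null.
Local Open Scope ereal_scope.
Context d (T : measurableType d) {R : realType} (mu : {measure set T -> \bar R}).
Import HBNNSimple.

(* The integral of [f] is a supremum over the simple functions below it, so the possibly non-measurable SOLIT loss can be compared with a measurable bound. *)
Lemma integral_le_off_null (f g : T -> \bar R) (D : set T) :
  (forall x, 0 <= f x) -> (forall x, 0 <= g x) ->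
  measurable_fun [set: T] g -> measurable D -> mu D = 0 ->
  (forall x, ~ D x -> f x <= g x) -> \int[mu]_x f x <= \int[mu]_x g x.
Proof.
move=> f0 g0 mg mD D0 fg; rewrite ge0_integralTE//.
apply: ge_ereal_sup => _ [h hf <-]; rewrite -integralT_nnsfun.
apply: ae_ge0_le_integral => //.
- by move=> x _; rewrite lee_fin; exact: fun_ge0.
- exact/measurable_EFinP.
exists D; split=> // x /= hx; apply: contrapT => nD; apply: hx => _.
exact: le_trans (hf x) (fg _ nD).
Qed.

End integral_off_null.

Section variance_increments.
Context {R : realType}.
Variable lam : nat -> R.
Hypothesis lam_ge0 : forall k, 0 <= lam k.

(* Weighted Young inequality [(x + y)^2 <= (1 + c) x^2 + (1 + 1/c) y^2] with [c = (theta - 1) / 2]. *)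
Lemma variance_increment_ge (theta : R) (u1 u2 : nat -> R) : 1 < theta ->
  (forall k, 0 <= u1 k) -> (forall k, u1 k <= u2 k) ->
  cvgn (series (fun k => lam k * u1 k ^+ 2)) ->
  cvgn (series (fun k => lam k * u2 k ^+ 2)) ->
  cvgn (series (fun k => lam k * (u1 k - u2 k) ^+ 2)) ->
  theta * limn (series (fun k => lam k * u1 k ^+ 2)) <=
    limn (series (fun k => lam k * u2 k ^+ 2)) ->
  (theta - 1) ^+ 2 / (2 * (theta + 1)) *
    limn (series (fun k => lam k * u1 k ^+ 2)) <=
  limn (series (fun k => lam k * (u1 k - u2 k) ^+ 2)).
Proof.
move=> th1 u10 u12 c1 c2 c12 h.
set V1 := limn _ in h *; set V12 := limn _; set V2 := limn _ in h.
pose c := (theta - 1) / 2; have c0 : 0 < c by rewrite divr_gt0// subr_gt0.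
pose w k := (1 + c) * (lam k * u1 k ^+ 2) + (1 + c^-1) * (lam k * (u1 k - u2 k) ^+ 2).
have wE : series w = (1 + c) *: series (fun k => lam k * u1 k ^+ 2) +
    (1 + c^-1) *: series (fun k => lam k * (u1 k - u2 k) ^+ 2).
  apply/funext => n.
  change (\sum_(0 <= k < n) w k = (1 + c) * (\sum_(0 <= k < n) lam k * u1 k ^+ 2) +
    (1 + c^-1) * (\sum_(0 <= k < n) lam k * (u1 k - u2 k) ^+ 2)).
  by rewrite !mulr_sumr -big_split.
have cw : series w @ \oo --> (1 + c) * V1 + (1 + c^-1) * V12.
  by rewrite wE; apply: cvgD; apply: cvgZr.
have : V2 <= (1 + c) * V1 + (1 + c^-1) * V12.
  rewrite -(cvg_lim (@Rhausdorff R) cw); apply: series_lim_le_series => //.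
    move=> k; rewrite /w !(mulrCA _ (lam k)) -mulrDr ler_wpM2l//.
    have -> : u2 k ^+ 2 = (1 + c) * u1 k ^+ 2 + (1 + c^-1) * (u1 k - u2 k) ^+ 2
       - (c * u1 k + (u1 k - u2 k)) ^+ 2 / c.
      by field; rewrite gt_eqF.
    by rewrite gerBl divr_ge0 ?sqr_ge0// ltW.
  by apply/cvg_ex; eexists; exact: cw.
move=> h2; have {h2}h2 : c * V1 <= (1 + c^-1) * V12.
  have -> : c * V1 = theta * V1 - (1 + c) * V1 by rewrite /c; field.
  by rewrite lerBlDl (le_trans h).
have cc : 0 < 1 + c^-1 by rewrite addr_gt0// invr_gt0.
rewrite -(ler_pM2l cc); apply: le_trans h2; rewrite mulrA le_eqVlt; apply/orP; left.
by apply/eqP; rewrite /c; field; rewrite !gt_eqF// ?subr_gt0// addr_gt0// (lt_trans ltr01).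
Qed.

End variance_increments.

Lemma min_natP (N : set nat) : N !=set0 ->
  N (min_nat N) /\ forall k, N k -> (min_nat N <= k)%N.
Proof.
move=> [n Nn]; rewrite /min_nat; case: xgetP => [m _ []//|noway]; exfalso.
have ex : exists n, `[< N n >] by exists n; exact/asboolP.
case: (ex_minnP ex) => m /asboolP Nm hm; apply: (noway m); split=> // k Nk.
by apply: hm; exact/asboolP.
Qed.

(** * The loss on a single path *)

Section pathwise.
Context {R : realType} (X : normedModType R).
Variables (fh u eta : nat -> X) (f : X) (s b H : R) (M ms : nat).
Variables (z w thr : nat -> nat -> R).
Hypotheses (s0 : 0 < s) (msM : (ms <= M)%N).
Hypothesis fhE : forall m, fh m = u m + s *: eta m.
Hypothesis bias_le : forall m, (ms <= m)%N -> `|u m - f| <= b.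
Hypothesis bias_inc : forall m1 m2, (ms <= m1)%N -> (m1 < m2)%N ->
  `|u m1 - u m2| <= w m1 m2.
Hypothesis thrE : forall m1 m2, thr m1 m2 = s * z m1 m2 + w m1 m2.
Hypothesis thr_le : forall m1, (m1 < ms)%N -> thr m1 ms <= H.

(** After a stop beyond [ms], the rejected index is [m1] and the accepted one [m1.+1], whose noise
    is what the loss contains. Both [m1] and the index [m2] that rejects it depend on the path, so
    the sum runs over all pairs. The factors [3] and [2] come from squaring sums of three and two
    terms. *)
Lemma stopped_loss_le (mh := min_nat [set m1 | (m1 <= M)%N /\
    forall m2, (m1 < m2 <= M)%N -> `|fh m1 - fh m2| <= thr m1 m2]) :
  `|fh mh - f| ^+ 2 <= 3 * H ^+ 2 + 3 * b ^+ 2 + 3 * s ^+ 2 * `|eta ms| ^+ 2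
    + 2 * s ^+ 2 * \sum_(0 <= m1 < M) \sum_(0 <= m2 < M.+1)
        (((m1 < m2)%N && (z m1 m2 < `|eta m1 - eta m2|))%:R *
         `|eta m1.+1| ^+ 2).
Proof.
have [[mhM mhP] mhmin] : ((mh <= M)%N /\
    forall m2, (mh < m2 <= M)%N -> `|fh mh - fh m2| <= thr mh m2) /\
    forall k, ((k <= M)%N /\ forall m2, (k < m2 <= M)%N ->
      `|fh k - fh m2| <= thr k m2) -> (mh <= k)%N.
  apply: min_natP; exists M; split=> // m2 /andP[h1 h2].
  by have := leq_trans h1 h2; rewrite ltnn.
clearbody mh.
have T0 m1 m2 : 0 <= ((m1 < m2)%N && (z m1 m2 < `|eta m1 - eta m2|))%:R *
    `|eta m1.+1| ^+ 2 by rewrite mulr_ge0 ?sqr_ge0.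
have loss m : (ms <= m)%N -> `|fh m - f| <= b + s * `|eta m|.
  move=> hm; rewrite fhE addrAC; apply: le_trans (ler_normD _ _) _.
  by rewrite normrZ (gtr0_norm s0) lerD2r bias_le.
have b0 : 0 <= b by exact: le_trans (normr_ge0 _) (bias_le (leqnn ms)).
have [mhms|msmh] := leqP mh ms.
  (* No sign is assumed on [H], and the bound must also hold for [mh = ms], where no threshold is
     involved. *)
  have h : `|fh mh - f| <= `|H| + b + s * `|eta ms|.
    move: mhms; rewrite leq_eqVlt => /predU1P[->|mhms].
      by apply: le_trans (loss _ (leqnn ms)) _; rewrite lerD2r lerDr.
    rewrite -(subrKA (fh ms)); apply: le_trans (ler_normD _ _) _.
    rewrite -addrA; apply: lerD; last exact: loss.
    apply: le_trans (mhP ms _) _; first by rewrite mhms.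
    exact: le_trans (thr_le mhms) (ler_norm _).
  set S := \sum_(_ <= _ < _) _.
  have S0 : 0 <= 2 * s ^+ 2 * S.
    apply: mulr_ge0; first by rewrite mulr_ge0 ?sqr_ge0.
    by apply: sumr_ge0 => i _; exact: sumr_ge0.
  apply: (@le_trans _ _ ((`|H| + b + s * `|eta ms|) ^+ 2)).
    by rewrite ler_pXn2r ?nnegrE ?(le_trans _ h).
  rewrite -[H ^+ 2]real_normK ?num_real//.
  have := sqr_ge0 (`|H| - b); have := sqr_ge0 (`|H| - s * `|eta ms|).
  have := sqr_ge0 (b - s * `|eta ms|).
  by move: S0; move: (`|H|) (`|eta ms|) (2 * s ^+ 2 * S) => h1 e1 S1; nra.
case: mh mhM mhP mhmin msmh => [//|m] mM _ mmin msm.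
have [m2 /andP[m2m m2M] /negP] : exists2 m2, (m < m2 <= M)%N &
    ~ (`|fh m - fh m2| <= thr m m2).
  apply: contrapT => nex.
  have : (m.+1 <= m)%N; last by rewrite ltnn.
  apply: mmin; split=> [|m2 hm2]; first exact: ltnW.
  by apply: contrapT => h; apply: nex; exists m2.
rewrite -ltNge thrE => hlt.
(* The bias part of the difference is at most [w m m2]; what exceeds the threshold is therefore
   noise above its quantile. *)
have zlt : z m m2 < `|eta m - eta m2|.
  rewrite -(ltr_pM2l s0) -(ltrD2r (w m m2)); apply: lt_le_trans hlt _.
  rewrite !fhE opprD addrACA -scalerBr addrC; apply: le_trans (ler_normD _ _) _.
  by rewrite normrZ (gtr0_norm s0) lerD// bias_inc.
have term : `|eta m.+1| ^+ 2 <= \sum_(0 <= m1 < M) \sum_(0 <= m2 < M.+1)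
    (((m1 < m2)%N && (z m1 m2 < `|eta m1 - eta m2|))%:R * `|eta m1.+1| ^+ 2).
  rewrite big_mkord (bigD1 (Ordinal mM))//= big_mkord.
  have m2M' : (m2 < M.+1)%N by rewrite ltnS.
  rewrite (bigD1 (Ordinal m2M'))//= m2m zlt/= mul1r -addrA lerDl.
  by apply: addr_ge0; apply: sumr_ge0 => i _ //; exact: sumr_ge0.
have h := loss _ (ltnW msm).
apply: (@le_trans _ _ ((b + s * `|eta m.+1|) ^+ 2)).
  by rewrite ler_pXn2r ?nnegrE ?(le_trans _ h).
have := ler_wpM2l (mulr_ge0 (ler0n R 2) (sqr_ge0 s)) term.
move: (\sum_(_ <= _ < _) _) => S.
have := sqr_ge0 (b - s * `|eta m.+1|); have := sqr_ge0 (s * `|eta ms|).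
by have := sqr_ge0 H; have := sqr_ge0 b; nra.
Qed.

End pathwise.

(** * Expectation of the pathwise bound *)

Section mean_le.
Local Open Scope ereal_scope.
Context {R : realType} d (Omega : measurableType d) (P : probability Omega R).

(** Measurability and sign travel with the bound, since adding and scaling integrals requires them
    each time. *)
Definition mean_le (g : Omega -> \bar R) (c : R) : Prop :=
  [/\ measurable_fun setT g, forall w, 0 <= g w & \int[P]_w g w <= c%:E].

Lemma mean_le_cst (c : R) : (0 <= c)%R -> mean_le (cst c%:E) c.
Proof.
by move=> c0; split=> //; have := expectation_cst P c; rewrite unlock => ->.
Qed.

Lemma mean_leD g1 g2 c1 c2 : mean_le g1 c1 -> mean_le g2 c2 ->
  mean_le (fun w => g1 w + g2 w) (c1 + c2).
Proof.
move=> [m1 p1 h1] [m2 p2 h2]; split.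
- exact: emeasurable_funD.
- by move=> w; rewrite adde_ge0.
- by rewrite ge0_integralD// EFinD leeD.
Qed.

Lemma mean_leZ k g c : (0 <= k)%R -> mean_le g c ->
  mean_le (fun w => k%:E * g w) (k * c).
Proof.
move=> k0 [m p h]; split.
- exact: measurable_funeM.
- by move=> w; rewrite mule_ge0.
- by rewrite ge0_integralZl_EFin// EFinM lee_wpmul2l.
Qed.

Lemma mean_le_sum (n : nat) (g : nat -> Omega -> \bar R) (c : R) :
  (forall i, (i < n)%N -> mean_le (g i) c) ->
  mean_le (fun w => \sum_(0 <= i < n) g i w) (n%:R * c).
Proof.
elim: n => [|n IHn] h.
  rewrite mul0r (_ : (fun _ => _) = cst 0); first exact: mean_le_cst.
  by apply/funext => w; rewrite big_geq.
rewrite (_ : (fun _ => _) = (fun w => \sum_(0 <= i < n) g i w + g n w)).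
  rewrite -natr1 mulrDl mul1r; apply: mean_leD; last exact: h.
  by apply: IHn => i ni; apply: h; exact: ltnW.
by apply/funext => w; rewrite big_nat_recr.
Qed.

Lemma mean_le_indic (B : set Omega) c : measurable B -> P B <= c%:E ->
  mean_le (fun w => (\1_B w)%:E) c.
Proof.
move=> mB PB; split.
- by apply/measurable_EFinP; exact: measurable_indic.
- by move=> w; rewrite lee_fin.
- by rewrite integral_indic// setIT.
Qed.

End mean_le.

Section expected_loss.
Local Open Scope ereal_scope.
Context {R : realType} d (Omega : measurableType d) (P : probability Omega R).
Variables (xi : nat -> {RV P >-> R}) (lam : nat -> R).
Hypothesis xi_gauss : forall (n : nat) (c : 'I_n -> R),
  is_gaussian P (fun w => \sum_(i < n) c i * xi i w)%R.
Hypothesis xi_center : forall k, 'E_P[xi k] = 0.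
Hypothesis xi_cov : forall j k,
  covariance P (xi j) (xi k) = (lam k * (j == k)%:R)%:E.
Hypothesis lam_ge0 : forall k, (0 <= lam k)%R.
Hypothesis lam_cvg : cvgn (series lam).
Variables (Q : nat -> nat -> R) (K : nat -> R).
Hypothesis Q_bounded : forall m k, (Q m k ^+ 2 <= K m)%R.

Let V m := limn (series (fun k => lam k * Q m k ^+ 2)%R).

Let V_cvg m : cvgn (series (fun k => lam k * Q m k ^+ 2)%R).
Proof.
under eq_fun do rewrite mulrC.
by apply: (cvg_series_mul_bounded (K := K m)) => // k; rewrite sqr_ge0/=.
Qed.

Hypothesis V_gt0 : forall m, (0 < V m)%R.

Let tm m k : R := (Q m k ^+ 2 / (4 * V m))%R.
Let NE m := exp_series xi (tm m).

Let tm_ge0 m k : (0 <= tm m k)%R.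
Proof. by rewrite divr_ge0 ?sqr_ge0// mulr_ge0// ltW. Qed.

Let term_ge0 m k : (0 <= lam k * Q m k ^+ 2)%R.
Proof. by rewrite mulr_ge0 ?sqr_ge0. Qed.

Let tm_lam m : (fun k => tm m k * lam k)%R =
  ((4 * V m)^-1 *: (fun k => lam k * Q m k ^+ 2)%R : nat -> R).
Proof.
apply/funext => k; change (tm m k * lam k = (4 * V m)^-1 * (lam k * Q m k ^+ 2))%R.
by rewrite /tm; ring.
Qed.

Let noise_mgf m : mean_le P (NE m) (expR 2^-1).
Proof.
have tlam k : (tm m k * lam k <= 4^-1)%R.
  have le_V : (lam k * Q m k ^+ 2 <= V m)%R.
    apply: le_trans (le_series_lim k.+1 (term_ge0 m) (@V_cvg m)).
    by rewrite big_nat_recr//= lerDr sumr_ge0.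
  rewrite /tm mulrAC ler_pdivrMr ?mulr_gt0// mulKf//.
  by rewrite mulrC.
have tcvg : cvgn (series (fun k => tm m k * lam k)%R).
  by rewrite tm_lam; exact: is_cvg_seriesZ.
split.
- exact: measurable_exp_series.
- exact: exp_series_ge0.
- apply: le_trans (integral_exp_series xi_gauss xi_center xi_cov (tm_ge0 m) tlam tcvg) _.
  rewrite lee_fin ler_expR tm_lam lim_seriesZ// -/(V m) le_eqVlt; apply/orP; left.
  by apply/eqP; change (2 * ((4 * V m)^-1 * V m) = 2^-1)%R; field; rewrite gt_eqF.
Qed.

(** The energy and its square are dominated by the same exponential variable, through [y <= exp y]
    and [y^2 <= 4 exp y], so that only the mean of [NE] has to be known. *)
Let noise_le m w (N : R) : ~ divergence_set xi w ->
  N = limn (series (fun k => Q m k ^+ 2 * xi k w ^+ 2)%R) ->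
  exists E : R, [/\ NE m w = E%:E, (0 <= E)%R, (N <= 4 * V m * E)%R
    & (N ^+ 2 <= 64 * V m ^+ 2 * E)%R].
Proof.
move=> /contrapT cxi ->; set N' := limn _.
have cN : cvgn (series (fun k => Q m k ^+ 2 * xi k w ^+ 2)%R).
  apply: (cvg_series_mul_bounded (K := K m) _ _ cxi) => k; first exact: sqr_ge0.
  by rewrite sqr_ge0/=.
have N0 : (0 <= N')%R.
  by apply: series_lim_ge0 => // k; rewrite mulr_ge0 ?sqr_ge0.
have tE : (fun k => tm m k * xi k w ^+ 2)%R =
    ((4 * V m)^-1 *: (fun k => Q m k ^+ 2 * xi k w ^+ 2)%R : nat -> R).
  apply/funext => k.
  change (tm m k * xi k w ^+ 2 = (4 * V m)^-1 * (Q m k ^+ 2 * xi k w ^+ 2))%R.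
  by rewrite /tm; ring.
pose y := ((4 * V m)^-1 * N')%R.
have y0 : (0 <= y)%R by rewrite mulr_ge0// invr_ge0 mulr_ge0// ltW.
have NV : (N' = 4 * V m * y)%R by rewrite /y mulrA divff ?mul1r// gt_eqF// mulr_gt0.
exists (expR y); split.
- rewrite /NE exp_seriesE ?tE; first by rewrite lim_seriesZ.
  exact: is_cvg_seriesZ.
- exact: expR_ge0.
- rewrite NV ler_pM2l ?mulr_gt0//; have := expR_ge1Dx y; lra.
- have h : (y ^+ 2 <= 4 * expR y)%R.
    have := expR_ge1Dx (y / 2); have -> : expR y = (expR (y / 2) ^+ 2)%R.
      by rewrite -expRM_natl; congr expR; field.
    by move: (expR _) => E hE; nra.
  rewrite NV exprMn; have := ler_wpM2l (sqr_ge0 (4 * V m)%R) h; lra.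
Qed.

Variables (gamma s c0 : R) (M ms : nat) (loss : Omega -> R).
Variables (eta2 : nat -> Omega -> R) (B : nat -> nat -> set Omega).
Hypotheses (gamma0 : (0 < gamma)%R) (c0_ge0 : (0 <= c0)%R).
Hypothesis V0_le : forall m, (V 0 <= V m)%R.
Hypothesis loss_ge0 : forall w, (0 <= loss w)%R.
Hypothesis B_meas : forall m1 m2, measurable (B m1 m2).
Hypothesis B_prob : forall m1 m2, (m1 < m2)%N ->
  P (B m1 m2) = (expR (- (2 * (1 + gamma) * ln (V m1.+1 / V 0))))%:E.
Hypothesis eta2E : forall m w, ~ divergence_set xi w ->
  eta2 m w = limn (series (fun k => Q m k ^+ 2 * xi k w ^+ 2)%R).
Hypothesis loss_le : forall w, ~ divergence_set xi w ->
  (loss w <= c0 + 3 * s ^+ 2 * eta2 ms w + 2 * s ^+ 2 *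
    \sum_(0 <= m1 < M) \sum_(0 <= m2 < M.+1)
      (((m1 < m2)%N && (w \in B m1 m2))%:R * eta2 m1.+1 w))%R.

(* On [B] the noise [N] at [m] is split by [N <= N^2 / (2 u) + u / 2] with [u = V m (V m / V 0)^(1 + gamma)]: both means are then of order [V 0]. *)
Lemma expected_loss_le :
  \int[P]_w (loss w)%:E <=
  (c0 + 12 * s ^+ 2 * V ms * expR 2^-1 +
   2 * s ^+ 2 * (M%:R * (M.+1%:R * (32 * V 0 * expR 2^-1 + V 0 / 2))))%:E.
Proof.
pose U m : R := (V m * expR ((1 + gamma) * ln (V m / V 0)))%R.
(* The probability of [B m1 m2] is known only for [m1 < m2]; the other pairs do not occur in the
   sum. *)
pose B' m1 m2 : set Omega := if (m1 < m2)%N then B m1 m2 else set0.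
have U0 m : (0 < U m)%R by rewrite mulr_gt0 ?expR_gt0.
have VV m : (1 <= V m / V 0)%R by rewrite ler_pdivlMr// mul1r.
have lV m : (0 <= ln (V m / V 0))%R by rewrite ln_ge0.
have mB' m1 m2 : measurable (B' m1 m2) by rewrite /B'; case: ifP.
(* With [l = ln (V m1.+1 / V 0)], the probability is [exp (- 2 (1 + gamma) l)], whereas
   [V 0 / U m1.+1 = exp (- (2 + gamma) l)]. *)
have PB' m1 m2 : P (B' m1 m2) <= (V 0 / U m1.+1)%:E.
  rewrite /B'; case: ifPn => [m12|_]; last by rewrite measure0 lee_fin divr_ge0// ltW.
  rewrite B_prob// lee_fin ler_pdivlMr// /U mulrCA -expRD.
  have V0E : V 0%N = (V m1.+1 * expR (- ln (V m1.+1 / V 0)))%R.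
    rewrite expRN lnK ?posrE ?divr_gt0// invf_div mulrCA divff ?mulr1//.
    by rewrite gt_eqF.
  rewrite [leRHS]V0E ler_pM2l// ler_expR.
  by have := mulr_ge0 (ltW gamma0) (lV m1.+1); lra.
pose G w := (c0%:E + (12 * s ^+ 2 * V ms)%:E * NE ms w) +
  (2 * s ^+ 2)%:E * \sum_(0 <= m1 < M) \sum_(0 <= m2 < M.+1)
    ((32 * V 0)%:E * NE m1.+1 w + (U m1.+1 / 2)%:E * (\1_(B' m1 m2) w)%:E).
have s2 : (0 <= s ^+ 2)%R by exact: sqr_ge0.
have bG : mean_le P G (c0 + 12 * s ^+ 2 * V ms * expR 2^-1 +
   2 * s ^+ 2 * (M%:R * (M.+1%:R * (32 * V 0 * expR 2^-1 + V 0 / 2)))).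
  apply: mean_leD.
    apply: mean_leD; first exact: mean_le_cst.
    apply: mean_leZ; last exact: noise_mgf.
    exact: mulr_ge0 (mulr_ge0 (ler0n _ 12) s2) (ltW (V_gt0 _)).
  apply: mean_leZ; first by rewrite mulr_ge0.
  apply: mean_le_sum => m1 _; apply: mean_le_sum => m2 _; apply: mean_leD.
    by apply: mean_leZ; [rewrite mulr_ge0// ltW|exact: noise_mgf].
  have -> : (V 0 / 2 = U m1.+1 / 2 * (V 0 / U m1.+1))%R.
    by field; rewrite gt_eqF.
  apply: mean_leZ; first by rewrite divr_ge0// ltW.
  exact: mean_le_indic.
have [mG G0 IG] := bG; apply: le_trans IG.
apply: (integral_le_off_null (D := divergence_set xi)) => //.
- exact: measurable_divergence_set.
- exact: (divergence_set_null xi_center xi_cov).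
move=> w nD; rewrite /G.
have /choice[E hE] m := noise_le nD (eta2E m nD).
have E0 m : (0 <= E m)%R by case: (hE m).
have EE m : NE m w = (E m)%:E by case: (hE m).
have E1 m : (eta2 m w <= 4 * V m * E m)%R by case: (hE m).
have E2 m : (eta2 m w ^+ 2 <= 64 * V m ^+ 2 * E m)%R by case: (hE m).
rewrite EE; under eq_bigr do under eq_bigr do rewrite EE -!EFinM -EFinD.
under eq_bigr do rewrite sumEFin.
rewrite sumEFin -!EFinM -!EFinD lee_fin; apply: le_trans (loss_le nD) _.
apply: lerD; first rewrite lerD2l.
  have := ler_wpM2l (mulr_ge0 (ler0n R 3) s2) (E1 ms); lra.
apply: ler_wpM2l; first by rewrite mulr_ge0.
apply: ler_sum => m1 _; apply: ler_sum => m2 _.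
rewrite /B' indicE; case: ifPn => m12; last first.
  by rewrite mul0r addr_ge0// mulr_ge0// ?mulr_ge0 ?divr_ge0// ltW.
case: (w \in B m1 m2); last by rewrite mul0r mulr0 addr0 mulr_ge0// mulr_ge0// ltW.
rewrite mul1r mulr1.
have VU : (V m1.+1 ^+ 2 / U m1.+1 <= V 0)%R.
  rewrite ler_pdivrMr// /U expr2 mulrCA ler_pM2l//.
  have VE : V m1.+1 = (V 0 * expR (ln (V m1.+1 / V 0)))%R.
    by rewrite lnK ?posrE ?divr_gt0// mulrCA divff ?mulr1// gt_eqF.
  rewrite [leLHS]VE ler_pM2l// ler_expR.
  by have := mulr_ge0 (ltW gamma0) (lV m1.+1); lra.
have u0 := U0 m1.+1; move: (E2 m1.+1) (E0 m1.+1) VU u0.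
move: (eta2 _ _) (E _) (V m1.+1) (U _) => n1 e1 v1 u1 h1 h2 h3 u0.
have h4 : (n1 <= n1 ^+ 2 / (2 * u1) + u1 / 2)%R.
  rewrite -subr_ge0 (_ : _ - _ = (n1 - u1) ^+ 2 / (2 * u1))%R.
    by rewrite divr_ge0 ?sqr_ge0// mulr_ge0// ltW.
  by field; rewrite gt_eqF.
apply: le_trans h4 _; rewrite lerD2r ler_pdivrMr ?mulr_gt0//.
apply: le_trans h1 _; move: h3; rewrite ler_pdivrMr// => h3.
by have := ler_wpM2r h2 h3; lra.
Qed.

End expected_loss.

(** * Risk of the SOLIT estimator at a given comparison index *)

Section solit.
Context {R : realType} (X Y : completeNormedModType R).
Context (ipX : {dot X for idfun}) (ipY : {dot Y for idfun}).
Hypothesis ipX_norm : forall x : X, `|x| ^+ 2 = ipX x x.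
Variables (T : {linear X -> Y}) (Ts : Y -> X).
Hypothesis T_adj : is_adjoint ipX ipY T Ts.
Variables (lam : nat -> R) (e : nat -> X).
Hypothesis h_eig : eigenbasis ipX (Ts \o T) lam e.
Context d (Omega : measurableType d) (P : probability Omega R).
Variable Z : Y -> {RV P >-> R}.
Hypothesis hZ : standard_gaussian_process ipY Z.
Variables (q : R -> R -> R) (alpha : nat -> R) (Cq theta : R).
Let Q m k := q (alpha m) (lam k).
Hypothesis alpha_gt0 : forall m, 0 < alpha m.
Hypothesis Cq_gt0 : 0 < Cq.
Hypothesis Q_ge0 : forall m k, 0 <= Q m k.
Hypothesis Q_le1 : forall m k, lam k * Q m k <= 1.
Hypothesis Q_leC : forall m k, alpha m * Q m k <= Cq.
Hypothesis Q_mono : forall m1 m2 k, (m1 <= m2)%N -> Q m1 k <= Q m2 k.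
Let V m := filter_var lam (q (alpha m)).
Hypothesis V_gt0 : forall m, 0 < V m.
Hypothesis theta_gt1 : 1 < theta.
Hypothesis V_growth : forall m, theta * V m <= V m.+1.
Variables (z : nat -> nat -> R -> R) (beta gamma : R).
Hypotheses (beta_gt0 : 0 < beta) (gamma_gt0 : 0 < gamma).
Hypothesis h_z : noise_quantiles ipX lam e T q alpha Z z.

Let xi k : {RV P >-> R} := Z (T (e k)).

Let lam_gt0 k : 0 < lam k.
Proof. by case: h_eig => _ _ + _ _; apply. Qed.

Let lam_ge0 k : 0 <= lam k. Proof. exact: ltW. Qed.

Let lam_cvg : cvgn (series lam). Proof. by case: h_eig. Qed.

Let xi_gauss (n : nat) (c : 'I_n -> R) :
  is_gaussian P (fun w => \sum_(i < n) c i * xi i w).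
Proof. by case: hZ => + _ _; apply. Qed.

Let xi_center k : ('E_P[xi k] = 0)%E.
Proof. by case: hZ => _ + _; apply. Qed.

Let xi_cov j k : covariance P (xi j) (xi k) = (lam k * (j == k)%:R)%:E.
Proof. by case: hZ => _ _ ->; rewrite (ip_image_eigenvectors T_adj h_eig). Qed.

Let Q_le m k : Q m k <= Cq / alpha m.
Proof. by rewrite ler_pdivlMr// mulrC. Qed.

Let Q_norm m k : `|Q m k| <= Cq / alpha m.
Proof. by rewrite ger0_norm. Qed.

Let Q_sqr m k : Q m k ^+ 2 <= (Cq / alpha m) ^+ 2.
Proof. by rewrite ler_pXn2r ?nnegrE// (le_trans _ (Q_le m k)). Qed.

Let V_cvg m : cvgn (series (fun k => lam k * Q m k ^+ 2)).
Proof.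
under eq_fun do rewrite mulrC.
by apply: (cvg_series_mul_bounded (K := (Cq / alpha m) ^+ 2)) => // k; rewrite sqr_ge0/=.
Qed.

Let sub_le m1 m2 k : (m1 < m2)%N -> (Q m1 k - Q m2 k) ^+ 2 <= Q m2 k ^+ 2.
Proof.
move=> m12; have h1 := Q_ge0 m1 k; have h2 := Q_mono k (ltnW m12).
have := Q_ge0 m2 k; nra.
Qed.

Let sub_sqr m1 m2 k : (m1 < m2)%N ->
  (Q m1 k - Q m2 k) ^+ 2 <= (Cq / alpha m2) ^+ 2.
Proof. by move=> m12; apply: le_trans (sub_le k m12) _. Qed.

Let sub_cvg m1 m2 : (m1 < m2)%N ->
  cvgn (series (fun k => lam k * (Q m1 k - Q m2 k) ^+ 2)).
Proof.
move=> m12; under eq_fun do rewrite mulrC.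
apply: (cvg_series_mul_bounded (K := (Cq / alpha m2) ^+ 2)) => // k.
by rewrite sqr_ge0/= sub_sqr.
Qed.

Let V_mono m1 m2 : (m1 <= m2)%N -> V m1 <= V m2.
Proof.
move=> m12; apply: series_lim_le_series; [|exact: V_cvg|exact: V_cvg] => k.
change (lam k * Q m1 k ^+ 2 <= lam k * Q m2 k ^+ 2).
by rewrite ler_wpM2l// ler_pXn2r ?nnegrE// Q_mono.
Qed.

Let level s m : s != 0 ->
  solit_level lam q alpha gamma s m = 2 * (1 + gamma) * ln (V m.+1 / V 0).
Proof.
move=> s0; rewrite /solit_level -/(V m.+1) -/(V 0); congr (_ * ln _).
by field; rewrite s0 gt_eqF.
Qed.

Let V_lt m : V 0 < V m.+1.
Proof.
apply: lt_le_trans (V_mono (ltn0Sn m)); apply: lt_le_trans (V_growth 0).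
by rewrite ltr_pMl.
Qed.

Let level_gt0 s m : s != 0 -> 0 < solit_level lam q alpha gamma s m.
Proof.
move=> s0; rewrite level// mulr_gt0 ?mulr_gt0 ?addr_gt0//.
by rewrite ln_gt0// ltr_pdivlMr// mul1r.
Qed.

Let V12 m1 m2 := filter_var lam (fun x => q (alpha m1) x - q (alpha m2) x).

Let V12_ge m1 m2 : (m1 < m2)%N ->
  (theta - 1) ^+ 2 / (2 * (theta + 1)) * V m1 <= V12 m1 m2.
Proof.
move=> m12; apply: (variance_increment_ge lam_ge0 theta_gt1 (Q_ge0 m1)).
- by move=> k; apply: Q_mono; exact: ltnW.
- exact: V_cvg.
- exact: V_cvg.
- exact: sub_cvg.
- exact: le_trans (V_growth m1) (V_mono m12).
Qed.

Let V12_le m1 m2 : (m1 < m2)%N -> V12 m1 m2 <= V m2.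
Proof.
move=> m12; apply: series_lim_le_series; [|exact: sub_cvg|exact: V_cvg] => k.
change (lam k * (Q m1 k - Q m2 k) ^+ 2 <= lam k * Q m2 k ^+ 2).
by rewrite ler_wpM2l// sub_le.
Qed.

Let V12_ge0 m1 m2 : (m1 < m2)%N -> 0 <= V12 m1 m2.
Proof.
move=> m12; apply: series_lim_ge0; last exact: sub_cvg.
by move=> k; rewrite mulr_ge0// sqr_ge0.
Qed.

Let eta m w := estimator ipX lam e T (q (alpha m)) (Z ^~ w).

Let noise_cvgE m1 m2 w : ~ divergence_set xi w ->
  noise_diff ipX lam e T q alpha (Z ^~ w) m1 m2 =
  Num.sqrt (limn (series (fun k => (Q m1 k - Q m2 k) ^+ 2 * xi k w ^+ 2))).
Proof.
move=> /contrapT cxi; rewrite /noise_diff -[LHS]ger0_norm// -sqrtr_sqr.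
congr Num.sqrt; pose K := Num.max (Cq / alpha m1) (Cq / alpha m2).
rewrite (estimator_sub_norm (K := K) ipX_norm h_eig)// => k.
  by rewrite le_max Q_norm.
by rewrite le_max Q_norm orbT.
Qed.

Let noise_dvgE m1 m2 w : divergence_set xi w ->
  noise_diff ipX lam e T q alpha (Z ^~ w) m1 m2 =
  `|funcalc ipX lam e (q (alpha m1)) point - funcalc ipX lam e (q (alpha m2)) point|.
Proof. by move=> nc; exact: (estimator_dvg ipX_norm h_eig). Qed.

Let B m1 m2 x := [set w | z m1 m2 x < noise_diff ipX lam e T q alpha (Z ^~ w) m1 m2].

Let B_meas m1 m2 x : measurable (B m1 m2 x).
Proof.
pose K := (Cq / alpha m1 + Cq / alpha m2) ^+ 2.
apply: (measurable_noise_tail (g := fun k => Q m1 k - Q m2 k) (K := K)).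
- by move=> w; exact: noise_cvgE.
- by move=> w; exact: noise_dvgE.
- move=> k; have h : `|Q m1 k - Q m2 k| <= Cq / alpha m1 + Cq / alpha m2.
    by apply: le_trans (ler_normB _ _) _; rewrite lerD.
  rewrite -[leLHS]real_normK ?num_real// /K ler_pXn2r ?nnegrE//.
  exact: le_trans h.
Qed.

(* The covariance of the noise increment has trace at most [V m2] and largest eigenvalue at most [Cq / alpha m2], so its product with the level is still [O (V m2)]. *)
Lemma threshold_le (r c : R) : 1 < r -> 0 < c ->
  (forall m, c * alpha m `^ (- r) <= V m) ->
  exists2 C, 0 < C & forall s m1 m2, 0 < s -> (m1 < m2)%N ->
    solit_threshold lam q alpha z beta gamma s m1 m2 <= C * (s * Num.sqrt (V m2)).
Proof.
move=> r1 c0 cV; have [C1 C10 hC1] := log_level_bound r1 c0 (V_gt0 0).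
(* From [2 V + 4 x mu] with [x = 2 (1 + gamma) ln (V m1.+1 / V 0)] and [mu = Cq / alpha m2]; [C1]
   bounds the logarithm over [alpha m2] by [V m2]. *)
pose D := 2 + 8 * (1 + gamma) * Cq * C1.
have D0 : 0 < D by rewrite addr_gt0// !mulr_gt0// addr_gt0.
exists (Num.sqrt D + beta); first by rewrite addr_gt0// sqrtr_gt0.
move=> s m1 m2 s0 m12; rewrite /solit_threshold -/(V12 m1 m2).
have sn0 : s != 0 by rewrite gt_eqF.
rewrite sqrtrM ?sqr_ge0// sqrtr_sqr gtr0_norm// mulrDl; apply: lerD; last first.
  by rewrite ler_pM2l// ler_pM2l// ler_wsqrtr// V12_le.
set x := solit_level _ _ _ _ _ _.
have x0 : 0 < x by exact: level_gt0.
rewrite mulrCA ler_pM2l// -sqrtrM ?(ltW D0)//.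
have [z0|z0] := leP (z m1 m2 x) 0; first exact: le_trans z0 (sqrtr_ge0 _).
have mu0 : 0 < Cq / alpha m2 by rewrite divr_gt0.
have := quantile_le xi_gauss xi_center xi_cov lam_cvg (@noise_cvgE m1 m2)
  (@noise_dvgE m1 m2) (fun k => sub_sqr k m12) mu0 (ltW z0) _ (h_z m12 x0).
have gmu k : (Q m1 k - Q m2 k) ^+ 2 * lam k <= Cq / alpha m2.
  apply: le_trans (ler_wpM2r (lam_ge0 k) (sub_le k m12)) _.
  apply: le_trans (Q_le m2 k); rewrite expr2 -mulrA [Q m2 k * lam k]mulrC.
  by rewrite -[leRHS]mulr1 ler_wpM2l.
move=> /(_ gmu) h.
rewrite -[leLHS]ger0_norm ?(ltW z0)// -sqrtr_sqr ler_wsqrtr//; apply: le_trans h _.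
under eq_fun do rewrite mulrC; rewrite -[limn _]/(V12 m1 m2).
have h1 := V12_le m12.
have h2 : ln (V m1.+1 / V 0) / alpha m2 <= C1 * V m2.
  apply: le_trans (hC1 _ _ (alpha_gt0 m2) (V_mono (leq0n m2)) (cV m2)).
  rewrite ler_pM2r ?invr_gt0// ler_ln ?posrE ?divr_gt0//.
  by rewrite ler_pM2r ?invr_gt0// V_mono.
rewrite /x level// /D.
have h3 : 0 < 8 * (1 + gamma) * Cq by rewrite !mulr_gt0// addr_gt0.
move: h2; rewrite -(ler_pM2l h3); lra.
Qed.

(** Stated for any index [ms] whose bias is small relative to its standard deviation; the
    optimization over [ms] is separate. The constant in the bias condition is [beta^2] times the one
    relating [V12 m1 m2] to [V m1]. *)
Lemma solit_risk_le (s b H : R) (f : X) (ms : nat) (M := m_max lam q alpha s) :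
  0 < s -> (ms <= M)%N ->
  `|mean_estimator ipX lam e (q (alpha ms)) f - f| <= b ->
  b ^+ 2 <= beta ^+ 2 * ((theta - 1) ^+ 2 / (2 * (theta + 1))) * (s ^+ 2 * V ms) ->
  (forall m1, (m1 < ms)%N ->
    solit_threshold lam q alpha z beta gamma s m1 ms <= H) ->
  ('E_P[fun w => (`|solit_estimator ipX lam e T q alpha z beta gamma s
       (observation ipY T Z f s w) - f| ^+ 2)%R] <=
  (3 * H ^+ 2 + 3 * b ^+ 2 + 12 * s ^+ 2 * V ms * expR 2^-1 +
   2 * s ^+ 2 * (M%:R * (M.+1%:R * (32 * V 0 * expR 2^-1 + V 0 / 2))))%:E)%E.
Proof.
move=> s0 msM hb bV hH; have sn0 : s != 0 by rewrite gt_eqF.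
have b0 : 0 <= b by exact: le_trans hb.
pose x m1 := solit_level lam q alpha gamma s m1.
pose u m := mean_estimator ipX lam e (q (alpha m)) f.
rewrite unlock; apply: (expected_loss_le xi_gauss xi_center xi_cov lam_ge0 lam_cvg Q_sqr V_gt0
  (gamma := gamma) (eta2 := fun m w => `|eta m w| ^+ 2)
  (B := fun m1 m2 => B m1 m2 (x m1))) => //.
- by apply: addr_ge0; rewrite mulr_ge0 ?sqr_ge0.
- by move=> m; exact: V_mono.
- by move=> m1 m2 m12; rewrite -[P _]/(P (B m1 m2 (x m1))) h_z// ?level_gt0// /x level.
- move=> m w /contrapT cxi; have [e_onb _ _ _ _] := h_eig.
  rewrite (parseval ipX_norm e_onb).
  congr (limn (series _)); apply/funext => k.
  by rewrite (estimator_coord ipX_norm h_eig _ (Q_norm m))// exprMn.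
move=> w /contrapT cxi.
have split m : estimator ipX lam e T (q (alpha m)) (observation ipY T Z f s w) =
    u m + s *: eta m w.
  exact: (estimator_split ipX_norm T_adj h_eig (Q_ge0 m) (Q_le1 m) (Q_norm m)).
have := @stopped_loss_le R X
  (fun m => estimator ipX lam e T (q (alpha m)) (observation ipY T Z f s w))
  u (fun m => eta m w) f s b H M ms (fun m1 m2 => z m1 m2 (x m1))
  (fun m1 m2 => beta * (s * Num.sqrt (V12 m1 m2)))
  (solit_threshold lam q alpha z beta gamma s) s0 msM split.
have biasm m1 m2 : (m1 <= m2)%N -> `|u m2 - f| <= `|u m1 - f|.
  move=> m12; exact: (bias_monotone ipX_norm h_eig (g1 := q (alpha m1))
    (g2 := q (alpha m2)) (Q_ge0 m1) (fun k => Q_mono k m12) (Q_le1 m2)).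
have h1 m : (ms <= m)%N -> `|u m - f| <= b.
  by move=> h; exact: le_trans (biasm _ _ h) hb.
(* The bias at [m1] is at most [b], and [V12 m1 m2] dominates a multiple of [V m1 >= V ms], so the
   condition on [b] is enough for all pairs beyond [ms]. *)
have h2 m1 m2 : (ms <= m1)%N -> (m1 < m2)%N ->
    `|u m1 - u m2| <= beta * (s * Num.sqrt (V12 m1 m2)).
  move=> hm m12; apply: (@le_trans _ _ `|u m1 - f|).
    exact: (mean_estimator_sub ipX_norm h_eig (g1 := q (alpha m1))
      (g2 := q (alpha m2)) (Q_ge0 m1) (fun k => Q_mono k (ltnW m12)) (Q_le1 m2)).
  apply: le_trans (h1 _ hm) _.
  have w0 : 0 <= beta * (s * Num.sqrt (V12 m1 m2)).
    exact: mulr_ge0 (ltW beta_gt0) (mulr_ge0 (ltW s0) (sqrtr_ge0 _)).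
  rewrite -ler_sqr ?nnegrE// !exprMn sqr_sqrtr ?V12_ge0//.
  apply: le_trans bV _; rewrite -mulrA ler_wpM2l ?sqr_ge0// mulrCA ler_wpM2l ?sqr_ge0//.
  apply: le_trans (V12_ge m12); rewrite ler_wpM2l ?V_mono//.
  by rewrite divr_ge0 ?sqr_ge0// mulr_ge0// addr_ge0// (le_trans ler01)// ltW.
have h3 m1 m2 : solit_threshold lam q alpha z beta gamma s m1 m2 =
    s * z m1 m2 (x m1) + beta * (s * Num.sqrt (V12 m1 m2)).
  by rewrite /solit_threshold sqrtrM ?sqr_ge0// sqrtr_sqr gtr0_norm.
move=> /(_ h1 h2 h3 hH); rewrite /solit_estimator /solit_index.
move=> h; apply: le_trans h _; rewrite le_eqVlt; apply/orP; left; apply/eqP.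
congr (_ + _ * _); apply: eq_bigr => m1 _; apply: eq_bigr => m2 _.
congr (((_ && _)%:R) * _); apply/idP/idP => h; [by rewrite inE|by move: h; rewrite inE].
Qed.

End solit.

Lemma bernoulli_exprn (R : realDomainType) (x : R) n : 0 <= x ->
  1 + n%:R * x <= (1 + x) ^+ n.
Proof.
move=> x0; elim: n => [|n IHn]; first by rewrite mul0r addr0 expr0.
rewrite exprS -natr1; have := ler_wpM2l (addr_ge0 ler01 x0) IHn.
by have := mulr_ge0 (ler0n R n) (sqr_ge0 x); nra.
Qed.

(** * Choice of the comparison index *)

Section oracle.
Context {R : realType}.
Variables (alpha V : nat -> R) (nu tau r theta1 theta2 cl cu Cb kap : R).
Hypothesis h_nutau : 0 < nu \/ (nu = 0 /\ 0 < tau).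
Hypothesis r_gt1 : 1 < r.
Hypotheses (cl_gt0 : 0 < cl) (cu_gt0 : 0 < cu) (Cb_gt0 : 0 < Cb) (kap_gt0 : 0 < kap).
Hypothesis theta1_gt1 : 1 < theta1.
Hypotheses (alpha_gt0 : forall m, 0 < alpha m) (alpha_le : forall m, alpha m <= expR (- 1)).
Hypothesis V_ge : forall m, cl * alpha m `^ (- r) <= V m.
Hypothesis V_le : forall m, V m <= cu * alpha m `^ (- r).
Hypothesis V_growth : forall m, theta1 * V m <= V m.+1 <= theta2 * V m.

Let V_gt0 m : 0 < V m.
Proof. by apply: lt_le_trans (V_ge m); rewrite mulr_gt0// powR_gt0. Qed.

Let V_geom m : theta1 ^+ m * V 0 <= V m.
Proof.
elim: m => [|m IHm]; first by rewrite expr0 mul1r.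
have /andP[+ _] := V_growth m; apply: le_trans; rewrite exprS -mulrA ler_pM2l//.
by rewrite (lt_trans ltr01).
Qed.

(** [min_nat] is [0] on the empty set; geometric growth of the variances ensures that [m_max] is a
    genuine minimum. *)
Lemma sweep_end_exists s : 0 < s -> exists m, (0 < m)%N /\ 1 <= s ^+ 2 * V m.
Proof.
move=> s0; have D0 : 0 < s ^+ 2 * V 0 by rewrite mulr_gt0// exprn_gt0.
have x0 : 0 < theta1 - 1 by rewrite subr_gt0.
pose y := (s ^+ 2 * V 0 * (theta1 - 1))^-1.
have y0 : 0 < y by rewrite invr_gt0 mulr_gt0.
exists (Num.truncn y).+1; split=> //.
have /andP[_ h] := truncn_itv (ltW y0).
have h1 := bernoulli_exprn (Num.truncn y).+1 (ltW x0).
rewrite [1 + (theta1 - 1)]addrC subrK in h1.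
apply: (@le_trans _ _ (s ^+ 2 * (theta1 ^+ (Num.truncn y).+1 * V 0))); last first.
  by rewrite ler_pM2l ?exprn_gt0.
rewrite mulrCA mulrC; apply: (@le_trans _ _ (s ^+ 2 * V 0 *
    (1 + (Num.truncn y).+1%:R * (theta1 - 1)))); last by rewrite ler_pM2l.
move: h; rewrite /y -div1r ltr_pdivrMr ?mulr_gt0// => h.
have := D0; lra.
Qed.

(** For [t = sigma^2] and [r = 1 + 1/a] this is the claimed rate. *)
Definition rate (t : R) := t `^ (2 * nu / (2 * nu + r))
                           * (- ln t) `^ (- (2 * tau * r / (2 * nu + r))).

(** The variance at the first good index is read off its predecessor, which violates the bias
    condition and so satisfies the hypothesis of [rate_bound]; [theta2] limits the increase in
    between. If [ms = 0], the variance is only [O (sigma^2)]. *)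
Lemma oracle_index : exists C s1, [/\ 0 < C, 0 < s1 &
  forall s, 0 < s -> s < s1 ->
  let M := min_nat [set m | (0 < m)%N /\ 1 <= s ^+ 2 * V m] in
  exists2 ms, (ms <= M)%N &
    [/\ (Cb * phi_index nu tau (alpha ms)) ^+ 2 <= kap * (s ^+ 2 * V ms),
        s ^+ 2 * V ms <= C * rate (s ^+ 2)
      & s ^+ 2 * M.+1%:R ^+ 2 <= C * rate (s ^+ 2)]].
Proof.
have nu0 : 0 <= nu by case: h_nutau => [/ltW//|[->]].
have r0 : 0 < r by rewrite (lt_trans ltr01).
have c0 : 0 < kap * cl / Cb ^+ 2 by rewrite divr_gt0 ?mulr_gt0// exprn_gt0.
have [CR CR0 hR] := rate_bound tau nu0 r0 c0.
have [CL CL0 hL] := log_sqr_le_rate tau nu0 r0.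
have [CM CM0 hM] := geometric_index_bound theta1_gt1 (V_gt0 0).
have eta0 : 0 < Num.sqrt kap / Cb by rewrite divr_gt0// sqrtr_gt0.
have [del del0 hdel] := phi_index_small h_nutau eta0.
have th20 : 0 < theta2.
  have /andP[h1 h2] := V_growth 0; have := le_trans h1 h2.
  by rewrite ler_pM2r//; apply: lt_le_trans; rewrite (lt_trans ltr01).
pose C1 := V 0 * CL + theta2 * cu * CR.
have C10 : 0 < C1 by rewrite addr_gt0 ?mulr_gt0.
pose C2 := CM ^+ 2 * CL; have C20 : 0 < C2 by rewrite mulr_gt0// exprn_gt0.
have dr0 : 0 < del `^ r / cu by rewrite divr_gt0// powR_gt0.
exists (C1 + C2), (Num.min (expR (- 1)) (del `^ r / cu)); split.
- exact: addr_gt0.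
- by rewrite lt_min expR_gt0.
move=> s s0; rewrite lt_min => /andP[se sd] M.
have s1 : s < 1 by rewrite (lt_trans se)// -[ltRHS]expR0 ltr_expR ltrN10.
have s2s : s ^+ 2 <= s by rewrite expr2 ler_piMr// ltW.
have t0 : 0 < s ^+ 2 by rewrite exprn_gt0.
have te : s ^+ 2 <= expR (- 1) by rewrite (le_trans s2s)// ltW.
have l1 := oppr_ln_ge1 t0 te.
have rate0 : 0 <= rate (s ^+ 2) by rewrite mulr_ge0 ?powR_ge0.
have [[M0 MV] Mmin] : ((0 < M)%N /\ 1 <= s ^+ 2 * V M) /\
    forall k, ((0 < k)%N /\ 1 <= s ^+ 2 * V k) -> (M <= k)%N.
  by apply: min_natP; exact: sweep_end_exists.
have l2 : s ^+ 2 <= s ^+ 2 * (- ln (s ^+ 2)) ^+ 2.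
  by rewrite ler_peMr ?(ltW t0)// expr_ge1// (le_trans ler01).
pose good m := (Cb * phi_index nu tau (alpha m)) ^+ 2 <= kap * (s ^+ 2 * V m).
(* If [alpha M] exceeded [del], then [V M] would be at most [cu del^(- r)], too small for
   [s^2 V M >= 1] when [s < del^r / cu]. Hence [phi] is small at [M], and the condition holds. *)
have goodM : good M.
  have aM : alpha M <= del.
    rewrite leNgt; apply/negP => dM.
    have h : V M <= cu * del `^ (- r).
      apply: le_trans (V_le M) _; rewrite ler_pM2l// !powRN lef_pV2 ?posrE ?powR_gt0//.
      by rewrite ge0_ler_powR ?nnegrE ?ltW.
    have : s ^+ 2 * V M <= s ^+ 2 * (cu * del `^ (- r)) by rewrite ler_pM2l.
    move=> /(le_trans MV); rewrite powRN -[cu]invrK -invfM mulrC.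
    by rewrite [_ * del `^ r]mulrC ler_pdivlMl// mulr1 leNgt (le_lt_trans s2s).
  have ph0 := phi_index_gt0 nu tau (alpha_gt0 M) (alpha_le M).
  have h := hdel _ (alpha_gt0 M) (alpha_le M) aM.
  rewrite /good; apply: (@le_trans _ _ kap); last by rewrite ler_peMr// ltW.
  rewrite -[leRHS](@sqr_sqrtr _ kap) ?(ltW kap_gt0)//.
  rewrite ler_pXn2r ?nnegrE ?sqrtr_ge0 ?mulr_ge0 ?(ltW Cb_gt0) ?(ltW ph0)//.
  by rewrite mulrC -ler_pdivlMr.
have [gms msmin] := min_natP (ex_intro good M goodM).
set ms := min_nat good in gms msmin.
exists ms; first exact: msmin.
split=> //; last first.
  apply: (@le_trans _ _ (C2 * rate (s ^+ 2))); last by rewrite ler_wpM2r// lerDr ltW.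
  have hMl : M.+1%:R <= CM * - ln (s ^+ 2).
    case: (M) M0 Mmin => // n _ Mmin; rewrite -[n.+2]addn2 natrD; apply: hM => //.
    case: n Mmin => [|n] Mmin; [by left|right].
    apply: (@le_lt_trans _ _ (s ^+ 2 * V n.+1)); first by rewrite ler_pM2l.
    by rewrite ltNge; apply/negP => h; have := Mmin n.+1 (conj isT h); rewrite ltnn.
  apply: (@le_trans _ _ (s ^+ 2 * (CM * - ln (s ^+ 2)) ^+ 2)).
    by rewrite ler_pM2l// ler_pXn2r ?nnegrE// (le_trans _ hMl).
  rewrite exprMn mulrCA /C2 -mulrA ler_pM2l ?exprn_gt0// /rate [leRHS]mulrA.
  exact: (hL _ t0 te).
apply: (@le_trans _ _ (C1 * rate (s ^+ 2))); last by rewrite ler_wpM2r// lerDl ltW.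
rewrite /C1 mulrDl.
have V0le : s ^+ 2 * V 0 <= V 0 * CL * rate (s ^+ 2).
  rewrite mulrC -mulrA ler_pM2l// (le_trans l2)// /rate [leRHS]mulrA; exact: (hL _ t0 te).
have p0 : 0 <= theta2 * cu * CR * rate (s ^+ 2).
  by apply: mulr_ge0 => //; rewrite ltW// !mulr_gt0.
have p1 : 0 <= V 0 * CL * rate (s ^+ 2).
  by apply: mulr_ge0 => //; rewrite ltW// mulr_gt0.
case: ms gms msmin => [|m] gm mmin; first by rewrite -[leLHS]addr0 lerD.
have ngood : ~ good m by move=> /mmin; rewrite ltnn.
rewrite -[leLHS]add0r lerD//.
apply: (@le_trans _ _ (s ^+ 2 * (theta2 * (cu * alpha m `^ (- r))))).
  rewrite ler_pM2l//; have /andP[_ h] := V_growth m; apply: le_trans h _.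
  by rewrite ler_pM2l.
rewrite [leLHS](_ : _ = theta2 * cu * (s ^+ 2 * alpha m `^ (- r))); last by ring.
rewrite -[leRHS]mulrA ler_pM2l ?mulr_gt0// /rate [leRHS]mulrA; apply: hR => //.
move/negP: ngood; rewrite /good -ltNge => ngood.
rewrite -(ler_pM2l (exprn_gt0 2 Cb_gt0)) -exprMn; apply: le_trans (ltW ngood).
rewrite [leLHS](_ : _ = kap * (s ^+ 2 * (cl * alpha m `^ (- r)))).
  by rewrite ler_pM2l// ler_pM2l.
by field; rewrite gt_eqF.
Qed.

End oracle.

(** * Uniform risk bound over the source set *)

Theorem theorem4p1 (R : realType)
    (X Y : completeNormedModType R)
    (ipX : {dot X for idfun}) (ipY : {dot Y for idfun})
    (hX : separable_hilbert ipX) (hY : separable_hilbert ipY)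
    (T : {linear X -> Y}) (Ts : Y -> X)
    (T_inj : injective T) (T_hs : hilbert_schmidt ipX T)
    (T_adj : is_adjoint ipX ipY T Ts)
    (lam : nat -> R) (e : nat -> X)
    (h_eig : eigenbasis ipX (Ts \o T) lam e)
    (h_lam1 : lam 0%N <= expR (- 1))
    (d : measure_display) (Omega : measurableType d)
    (P : probability Omega R) (Z : Y -> {RV P >-> R})
    (hZ : standard_gaussian_process ipY Z)
    (cmin cmax a : R) (h_cmin : 0 < cmin) (h_cmax : cmin <= cmax)
    (h_a : 1 < a)
    (h_decay : forall k : nat,
       cmin * k.+1%:R `^ (- a) <= lam k <= cmax * k.+1%:R `^ (- a))
    (nu tau rho : R) (h_nutau : 0 < nu \/ (nu = 0 /\ 0 < tau))
    (h_rho : 0 < rho)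
    (A : set R) (q : R -> R -> R)
    (h_filter : ordered_filter A (opnorm (Ts \o T)) q)
    (h_qual : qualification A (opnorm (Ts \o T)) (lam 0%N) q
                (phi_index nu tau))
    (theta1 theta2 : R) (alpha : nat -> R)
    (h_cand : candidate_sequence A lam q theta1 theta2 alpha)
    (h_alpha : forall m, alpha m \in `]0, lam 0%N])
    (S : R -> R)
    (S_cont : {within `]0, lam 0%N], continuous S})
    (S_ge0 : forall x : R, x \in `]0, lam 0%N] -> 0 <= S x)
    (S_asymp : exists c1 c2 : R, [/\ 0 < c1, 0 < c2 &
       forall x : R, x \in `]0, lam 0%N] ->
         c1 * x `^ (- a^-1) <= S x <= c2 * x `^ (- a^-1)])
    (cv : R) (h_cv : 0 < cv)
    (h_var : forall (s : R) (m : nat), 0 < s ->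
       cv * s ^+ 2 * (S (alpha m) / alpha m)
         <= s ^+ 2 * filter_var lam (q (alpha m)))
    (beta gamma : R) (h_beta : 0 < beta) (h_gamma : 0 < gamma)
    (z : nat -> nat -> R -> R)
    (h_z : noise_quantiles ipX lam e T q alpha Z z) :
  exists C : R, 0 < C /\
    \forall s \near 0^'+,
      (ereal_sup
         [set 'E_P[fun w =>
                 (`|solit_estimator ipX lam e T q alpha z beta gamma s
                      (observation ipY T Z f s w) - f| ^+ 2)%R]
         | f in source_set ipX lam e (phi_index nu tau) rho]
       <= (C * (s ^+ 2) `^ (2 * nu / (2 * nu + a^-1 + 1))
           * (- ln (s ^+ 2)) `^
               (- (2 * tau * (1 + a^-1) / (2 * nu + 1 + a^-1))))%R%:E)%E.
Proof.
have [hXn _] := hX; have [Tc _] := T_hs.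
have [_ _ lam0 lamd _] := h_eig.
have lamM k := eigenvalue_le_opnorm hXn (proj1 hY) Tc T_adj h_eig k.
have [_ _ q0 [Cq' hC] qmono] := h_filter.
have [th1 _ Aal adec Vr] := h_cand.
(* The filter constant comes without a sign; the maximum makes it positive. *)
pose Cq := Num.max Cq' 1.
have Cq0 : 0 < Cq by rewrite lt_max ltr01 orbT.
have al0 m : 0 < alpha m by have := h_alpha m; rewrite in_itv/= => /andP[].
have alle m : alpha m <= expR (- 1).
  by have := h_alpha m; rewrite in_itv/= => /andP[_ /le_trans]; apply.
have lamle k : lam k <= expR (- 1) by exact: le_trans (lamd _ _ (leq0n k)) h_lam1.
have Q0 m k : 0 <= q (alpha m) (lam k) by exact: q0.
have Q1 m k : lam k * q (alpha m) (lam k) <= 1.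
  by have [] := hC _ _ (Aal m) (lamM k).
have QC m k : alpha m * q (alpha m) (lam k) <= Cq.
  by have [h _] := hC _ _ (Aal m) (lamM k); rewrite le_max h.
have Qmono m1 m2 k : (m1 <= m2)%N -> q (alpha m1) (lam k) <= q (alpha m2) (lam k).
  move=> m12; apply: qmono => //.
  elim: m2 m12 => [|m2 IHm]; first by rewrite leqn0 => /eqP ->.
  rewrite leq_eqVlt => /predU1P[->//|/IHm]; apply: le_trans.
  exact: ltW (adec m2).
pose V m := filter_var lam (q (alpha m)).
have [c1 [c2 [c10 _ hS]]] := S_asymp.
have a0 : 0 < a by rewrite (lt_trans ltr01).
pose r := 1 + a^-1.
have r1 : 1 < r by rewrite ltrDl invr_gt0.
have VL m : cv * c1 * alpha m `^ (- r) <= V m.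
  (* The noise level cancels in the variance hypothesis, which is therefore read at level [1]. *)
  have := h_var 1 m ltr01; rewrite expr1n mulr1 mul1r; apply: le_trans.
  rewrite -mulrA ler_pM2l// ler_pdivlMr//; have /andP[+ _] := hS _ (h_alpha m).
  apply: le_trans; rewrite -mulrA ler_pM2l//.
  rewrite -{2}[alpha m]powRr1 ?(ltW (al0 m))// -powRD ?(gt_eqF (al0 m)) ?implybT//.
  by rewrite (_ : - r + 1 = - a^-1)// /r; ring.
have V0 m : 0 < V m.
  by apply: lt_le_trans (VL m); rewrite !mulr_gt0// powR_gt0.
have Vg m : theta1 * V m <= V m.+1 <= theta2 * V m.
  by have := Vr m; rewrite -/(V m) -/(V m.+1) ler_pdivlMr// ler_pdivrMr.
have Vg1 m : theta1 * V m <= V m.+1 by case/andP: (Vg m).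
have cmax0 : 0 < cmax by rewrite (lt_le_trans h_cmin).
have [CV CV0 hCV] := variance_sum_le h_cmin cmax0 h_a h_decay Cq0.
have al1 m : alpha m <= 1.
  by rewrite (le_trans (alle m))// -[leRHS]expR0 ler_expR lerN10.
have VU m : V m <= CV * alpha m `^ (- r).
  have bnd := hCV (alpha m) (fun k => q (alpha m) (lam k)) (al0 m) (al1 m)
    (Q0 m) (Q1 m) (QC m).
  have t0 k : 0 <= lam k * q (alpha m) (lam k) ^+ 2.
    by rewrite mulr_ge0 ?sqr_ge0// ltW.
  exact: series_lim_le (bounded_series_cvg t0 bnd) bnd.
have [Cphi' hq] := h_qual; pose Cphi := Num.max Cphi' 1.
have Cphi0 : 0 < Cphi by rewrite lt_max ltr01 orbT.
have phi0 m := phi_index_gt0 nu tau (al0 m) (alle m).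
have hbias m k : phi_index nu tau (lam k) * (1 - lam k * q (alpha m) (lam k)) <=
    Cphi * phi_index nu tau (alpha m).
  apply: (@le_trans _ _ (Cphi' * phi_index nu tau (alpha m))); last first.
    by rewrite ler_pM2r// le_max lexx.
  rewrite -lee_fin; apply: le_trans (hq _ (Aal m) (h_alpha m)).
  by apply: ereal_sup_ubound; exists (lam k); first exact: lamM.
have [Kphi _ hKphi] := phi_index_bounded h_nutau.
have phiK k : 0 <= phi_index nu tau (lam k) <= Kphi.
  by rewrite hKphi// ltW//; exact: phi_index_gt0.
pose kap := beta ^+ 2 * ((theta1 - 1) ^+ 2 / (2 * (theta1 + 1))).
have kap0 : 0 < kap.
  rewrite mulr_gt0 ?exprn_gt0// divr_gt0 ?exprn_gt0 ?subr_gt0//.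
  by rewrite mulr_gt0// addr_gt0// (lt_trans ltr01).
have [CT CT0 hCT] := threshold_le hXn T_adj h_eig hZ al0 Cq0 Q0 Q1 QC Qmono V0 th1 Vg1
  h_beta h_gamma h_z r1 (mulr_gt0 h_cv c10) VL.
have [C [s1 [C0 s10 hor]]] := oracle_index h_nutau r1 (mulr_gt0 h_cv c10) CV0
  (mulr_gt0 Cphi0 h_rho) kap0 th1 al0 alle VL VU Vg.
pose E := expR (2^-1 : R); have E0 : 0 < E by exact: expR_gt0.
(* [D1] collects what is proportional to the variance at [ms]: squared threshold, squared bias and
   noise. [D2] is the cost of a late stop per pair of indices. *)
pose D1 := 3 * CT ^+ 2 + 3 * kap + 12 * E.
pose D2 := 2 * (32 * V 0%N * E + V 0%N / 2).
have D10 : 0 < D1 by rewrite !addr_gt0// mulr_gt0// exprn_gt0.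
have D20 : 0 < D2 by rewrite mulr_gt0// addr_gt0// ?divr_gt0// !mulr_gt0.
exists ((D1 + D2) * C); split; first by rewrite mulr_gt0// addr_gt0.
near=> s.
have s0 : 0 < s by near: s; exact: nbhs_right_gt.
have ss1 : s < s1 by near: s; exact: nbhs_right_lt.
have [ms msM [h1 h2 h3]] := hor s s0 ss1.
(* The index [ms] and all constants are fixed before the truth is introduced, so the bound passes to
   the supremum. *)
apply: ge_ereal_sup => _ [f [g -> hg] <-].
have bl := source_bias_le hXn h_eig (Q0 ms) (Q1 ms) phiK
  (mulr_ge0 (ltW Cphi0) (ltW (phi0 ms))) (hbias ms) hg.
have bk : (Cphi * phi_index nu tau (alpha ms) * rho) ^+ 2 <= kap * (s ^+ 2 * V ms).
  by move: h1; rewrite mulrAC.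
have risk := solit_risk_le hXn T_adj h_eig hZ al0 Q0 Q1 QC Qmono V0 th1 Vg1
  h_beta h_gamma h_z s0 msM bl bk (fun m1 => hCT s m1 ms s0).
apply: le_trans risk _.
rewrite lee_fin -/(V ms) -/(V 0%N).
set M := m_max _ _ _ _.
have rE : (s ^+ 2) `^ (2 * nu / (2 * nu + a^-1 + 1)) *
    (- ln (s ^+ 2)) `^ (- (2 * tau * (1 + a^-1) / (2 * nu + 1 + a^-1))) =
    rate nu tau r (s ^+ 2).
  by rewrite /rate /r -!addrA [a^-1 + 1]addrC.
rewrite -[leRHS]mulrA rE.
apply: (@le_trans _ _ (D1 * (s ^+ 2 * V ms) + D2 * (s ^+ 2 * M.+1%:R ^+ 2))).
  apply: lerD.
    rewrite !exprMn sqr_sqrtr ?(ltW (V0 ms))// in bk *.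
    by rewrite /D1 -/E; lra.
  have MM : M%:R * M.+1%:R <= M.+1%:R ^+ 2 :> R.
    by rewrite expr2 ler_wpM2r// ler_nat.
  have hs : 0 <= s ^+ 2 * D2 by rewrite mulr_ge0 ?sqr_ge0 ?ltW.
  by have := ler_wpM2l hs MM; rewrite /D2 -/E; lra.
rewrite -[leRHS]mulrA [leRHS]mulrDl; apply: lerD; rewrite ler_pM2l//.
Unshelve. all: by end_near. Qed.
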